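(* Let $p\in[1,+\infty)$, let $\Omega\subset\mathbb{R}^d$ be a bounded open set with Lipschitz boundary, and let $|\cdot|_*$ be a norm on $\mathbb{R}^d$. Let $K$ be a kernel on $\mathbb{R}^d$ such that: (i) $K\notin L^1(\mathbb{R}^d)$; (ii) there is $c_0\in(0,1]$ such that $|x|_*\le|y|_*$ implies $K(x)\ge c_0K(y)$; (iii) there are positive constants $D$ and $C_D$ such that $|y|_*=2|x|_*$ and $|x|_*\le D$ imply $K(x)\le C_DK(y)$; (iv) $\int_{\mathbb{R}^d}K(z)\min\{1,|z|_2^p\}\,dz<+\infty$. Then $W^{K,p}(\Omega)$ is compactly embedded in $L^p(\Omega)$; that is, if $\{u_k\}_k\subset W^{K,p}(\Omega)$ satisfies $\sup_k\|u_k\|_{W^{K,p}(\Omega)}<+\infty$, then there exist a subsequence $\{u_{k_j}\}_j$ and $u\in W^{K,p}(\Omega)$ such that $u_{k_j}\to u$ in $L^p(\Omega)$ as $j\to+\infty$.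
   Context: Here $d\ge1$ and $|\cdot|_2$ is the Euclidean norm. A kernel is a measurable function $K:\mathbb{R}^d\to[0,+\infty]$ that is not a.e. equal to $0$. For an open set $\Omega\subset\mathbb{R}^d$ and $p\in[1,+\infty)$, $[u]_{W^{K,p}(\Omega)}:=\left(\int_{\Omega}\int_\Omega|u(x)-u(y)|^pK(x-y)\,dx\,dy\right)^{1/p}\in[0,+\infty]$, $W^{K,p}(\Omega):=\{u\in L^p(\Omega):[u]_{W^{K,p}(\Omega)}<+\infty\}$, and $\|u\|_{W^{K,p}(\Omega)}:=\|u\|_{L^p(\Omega)}+[u]_{W^{K,p}(\Omega)}$. *)

(* Defs.v *)
From HB Require Import structures.
From mathcomp Require Import all_boot all_order all_algebra.
From mathcomp Require Import all_classical all_reals all_analysis.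
From mathcomp Require Import measurable_realfun.

Set Implicit Arguments.
Unset Strict Implicit.
Unset Printing Implicit Defensive.
Import Order.TTheory GRing.Theory Num.Def Num.Theory.
Import numFieldNormedType.Exports.

Local Open Scope classical_set_scope.
Local Open Scope ring_scope.

Definition rV_display : measure_display. Proof. exact: default_measure_display. Qed.

(* The product sigma-algebra on R^n; it is the Borel one, see
   [measurable_rVE] below. *)
Section measurable_rV.
Context (R : realType) (n : nat).

Let coord (i : 'I_n) (v : 'rV[R]_n) : measurableTypeR R := v ord0 i.

Let rV_set0 : g_sigma_preimage coord set0.
Proof. exact: sigma_algebra0. Qed.

Let rV_setC A : g_sigma_preimage coord A -> g_sigma_preimage coord (~` A).
Proof. exact: sigma_algebraC. Qed.

Let rV_bigcup (F : (set 'rV[R]_n)^nat) :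
  (forall i, g_sigma_preimage coord (F i)) ->
  g_sigma_preimage coord (\bigcup_i (F i)).
Proof. exact: sigma_algebra_bigcup. Qed.

HB.instance Definition _ := @isMeasurable.Build rV_display
  'rV[R]_n (g_sigma_preimage coord) rV_set0 rV_setC rV_bigcup.

Lemma measurable_coord (i : 'I_n) :
  measurable_fun [set: 'rV[R]_n] (fun v => v ord0 i : R).
Proof.
move=> _ Y mY; rewrite setTI; apply: sub_sigma_algebra.
rewrite -bigcup_seq/=; exists i => /=; first by rewrite mem_index_enum.
by exists Y => //; rewrite setTI.
Qed.

Lemma measurable_fun_rVP d (T : measurableType d) (f : T -> 'rV[R]_n) :
  (forall i, measurable_fun [set: T] (fun x => f x ord0 i : R)) ->
  measurable_fun [set: T] f.
Proof.
move=> mf _ Y mY; rewrite setTI.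
suff /(_ _ mY) : measurable `<=` [set A | measurable (f @^-1` A)] by [].
apply: smallest_sub.
  split=> [|A /= mA|F /= mF].
  - by rewrite /= preimage_set0.
  - by rewrite setTD -preimage_setC; exact: measurableC.
  - by rewrite preimage_bigcup; exact: bigcup_measurable.
move=> A; rewrite -bigcup_seq => -[i _ [B mB <-]] /=.
by rewrite setTI -[X in measurable X]setTI; exact: mf.
Qed.

Lemma measurable_rV_box (A : 'I_n -> set R) :
  (forall i, measurable (A i)) ->
  measurable [set v : 'rV[R]_n | forall i, A i (v ord0 i)].
Proof.
move=> mA; rewrite (_ : mkset _ =
    \bigcap_(i in [set: 'I_n]) ((fun v : 'rV[R]_n => v ord0 i) @^-1` A i)).
  apply: fin_bigcap_measurable; first exact: finite_finset.
  by move=> i _; have := measurable_coord i measurableT (mA i); rewrite setTI.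
by apply/seteqP; split=> [v Av i _|v Av i]; [exact: Av|exact: (Av i)].
Qed.

Lemma open_measurable_rV (U : set 'rV[R]_n) : open U -> measurable U.
Proof.
move=> oU.
pose B (qk : 'rV[rat]_n * nat) : set 'rV[R]_n :=
  [set v | forall i, ball (ratr (qk.1 ord0 i) : R) qk.2.+1%:R^-1 (v ord0 i)].
rewrite (_ : U = \bigcup_qk (if `[< B qk `<=` U >] then B qk else set0)).
  apply: countable_bigcupT_measurable => [|qk]; first exact: countableP.
  case: ifPn => // _.
  apply: (@measurable_rV_box
    (fun i => ball (ratr (qk.1 ord0 i) : R) qk.2.+1%:R^-1)) => i.
  exact: measurable_ball.
apply/seteqP; split=> [x Ux|x [qk _]]; last by case: ifPn => // /asboolP; apply.
have /nbhs_ballP[e /= e0 xeU] : nbhs x U by exact: open_nbhs_nbhs.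
have [k ke] : exists k, k.+1%:R^-1 < e / 2 :> R.
  have [k _ /(_ _ (leqnn k))] := near_infty_natSinv_lt (PosNum (divr_gt0 e0 (ltr0n R 2))).
  by exists k.
have /choice[q xq] i : exists q : rat, ball (ratr q : R) k.+1%:R^-1 (x ord0 i).
  have /rat_in_itvoo[q] : x ord0 i - k.+1%:R^-1 < x ord0 i + k.+1%:R^-1.
    by rewrite ltrBlDr -addrA ltrDl addr_gt0.
  rewrite in_itv/= => /andP[q1 q2]; exists q.
  by apply: ball_sym; rewrite /ball/= ltr_distlC q1.
have xB : B (\row_i q i, k) x by move=> i /=; rewrite mxE.
exists (\row_i q i, k) => //; case: ifPn => // /asboolPn[].
move=> v vB; apply: xeU; split=> // i j; rewrite ord1 (splitr e).
apply: (@ball_triangle R R (ratr (q j) : R)).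
  by apply: ball_sym; apply: (le_ball (ltW ke)); exact: xq.
by have := vB j; rewrite /= mxE; exact/le_ball/ltW.
Qed.

Lemma measurable_rVE :
  @measurable _ 'rV[R]_n = <<s [set U : set 'rV[R]_n | open U] >>.
Proof.
apply/seteqP; split; last first.
  apply: smallest_sub; last exact: open_measurable_rV.
  exact: sigma_algebra_measurable.
apply: smallest_sub; first exact: smallest_sigma_algebra.
move=> A; rewrite -bigcup_seq => -[i _ [B mB <-]] /=; rewrite setTI.
pose T := g_sigma_algebraType [set U : set 'rV[R]_n | open U].
have mcoord : measurable_fun [set: T] (fun v : T => (v : 'rV[R]_n) ord0 i : R).
  apply: (measurability _ (RGenOpens.measurableE R)) => // _ [_ [a [b ->]] <-].
  rewrite setTI; apply: sub_sigma_algebra => /=.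
  apply: open_comp; last exact: interval_open.
  by move=> v _; exact: coord_continuous.
by have := mcoord measurableT _ mB; rewrite setTI.
Qed.

End measurable_rV.

Section lebesgue_rV.
Context (R : realType).
Implicit Type n : nat.
Local Open Scope ereal_scope.

Definition rV_cons n (p : R * 'rV[R]_n) : 'rV[R]_n.+1 :=
  \row_i oapp (p.2 ord0) p.1 (unlift ord0 i).

Definition rV_uncons n (v : 'rV[R]_n.+1) : R * 'rV[R]_n :=
  (v ord0 ord0, \row_j v ord0 (lift ord0 j)).

Lemma rV_cons0 n (p : R * 'rV[R]_n) : rV_cons p ord0 ord0 = p.1.
Proof. by rewrite mxE unlift_none. Qed.

Lemma rV_consS n (p : R * 'rV[R]_n) (j : 'I_n) :
  rV_cons p ord0 (lift ord0 j) = p.2 ord0 j.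
Proof. by rewrite mxE liftK. Qed.

Lemma rV_consK n : cancel (@rV_cons n) (@rV_uncons n).
Proof.
move=> p; rewrite /rV_uncons rV_cons0 [p in RHS]surjective_pairing.
by congr pair; apply/rowP => j; rewrite mxE rV_consS.
Qed.

Lemma rV_unconsK n : cancel (@rV_uncons n) (@rV_cons n).
Proof.
move=> v; apply/rowP => i; case: (unliftP ord0 i) => [j|] ->.
  by rewrite rV_consS mxE.
by rewrite rV_cons0.
Qed.

Lemma measurable_rV_cons n :
  measurable_fun [set: R * 'rV[R]_n] (@rV_cons n).
Proof.
apply: measurable_fun_rVP => i; case: (unliftP ord0 i) => [j|] ->.
  under eq_fun do rewrite rV_consS.
  exact: (measurableT_comp (measurable_coord j)).
under eq_fun do rewrite rV_cons0.
exact: measurable_fst.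
Qed.

Lemma measurable_rV_uncons n :
  measurable_fun [set: 'rV[R]_n.+1] (@rV_uncons n).
Proof.
apply: measurable_fun_pair; first exact: measurable_coord.
apply: measurable_fun_rVP => i; under eq_fun do rewrite mxE.
exact: measurable_coord.
Qed.

Section step.
Context n (m : {sigma_finite_measure set 'rV[R]_n -> \bar R}).

Definition lebesgue_rV_step : set 'rV[R]_n.+1 -> \bar R :=
  pushforward (lebesgue_measure \x m) (@rV_cons n).

Let step0 : lebesgue_rV_step set0 = 0.
Proof. by rewrite /lebesgue_rV_step /pushforward preimage_set0 measure0. Qed.

Let step_ge0 A : 0 <= lebesgue_rV_step A.
Proof. exact: (measure_ge0 (lebesgue_measure \x m)). Qed.

Let step_sigma_additive : semi_sigma_additive lebesgue_rV_step.
Proof.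
exact: (@measure_semi_sigma_additive _ _ _
  (measure_function_pushforward__canonical__measure_function_Measure
    (product_measure1 lebesgue_measure m) (@measurable_rV_cons n))).
Qed.

HB.instance Definition _ := isMeasure.Build _ _ _ lebesgue_rV_step
  step0 step_ge0 step_sigma_additive.

Let step_sigma_finite : sigma_finite setT lebesgue_rV_step.
Proof.
have [F FT Ffin] : sigma_finite setT (product_measure1 lebesgue_measure m).
  have /sigma_finiteP[F [TF ndF Foo]] := sigma_finiteT (@lebesgue_measure R).
  have /sigma_finiteP[G [TG ndG Goo]] := sigma_finiteT m.
  exists (fun k => F k `*` G k).
    rewrite -setXTT TF TG predeqE => -[x y]; split.
      move=> [/= [k _ Fkx] [l _ Gly]]; exists (maxn k l) => //; split.
      - by move: x Fkx; exact/subsetPset/ndF/leq_maxl.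
      - by move: y Gly; exact/subsetPset/ndG/leq_maxr.
    by move=> [k _ []/= ? ?]; split; exists k.
  move=> k; have [? ?] := Foo k; have [? ?] := Goo k.
  split; first exact: measurableX.
  by rewrite product_measure1E// lte_mul_pinfty// ge0_fin_numE.
exists (fun k => @rV_uncons n @^-1` F k).
  by rewrite -preimage_bigcup -FT preimage_setT.
move=> k; have [mF Foo] := Ffin k; split.
  by rewrite -[X in measurable X]setTI; exact: measurable_rV_uncons.
rewrite /lebesgue_rV_step /pushforward -comp_preimage.
suff -> : @rV_uncons n \o @rV_cons n = id by rewrite preimage_id.
by apply/funext => p; exact: rV_consK.
Qed.

HB.instance Definition _ := Measure_isSigmaFinite.Build _ _ _ lebesgue_rV_step
  step_sigma_finite.

End step.

(* Iterated product of the Lebesgue measure on R; R^0 is a single point, of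
   mass 1.  [lebesgue_rV_box] computes it on boxes. *)
Fixpoint lebesgue_rV n : {sigma_finite_measure set 'rV[R]_n -> \bar R} :=
  match n with
  | 0 => [the {sigma_finite_measure set _ -> \bar R} of dirac (0%R : 'rV[R]_0)]
  | k.+1 => [the {sigma_finite_measure set _ -> \bar R} of
              lebesgue_rV_step (lebesgue_rV k)]
  end.

Lemma lebesgue_rV_box n (A : 'I_n -> set R) :
  (forall i, measurable (A i)) ->
  lebesgue_rV n [set v | forall i, A i (v ord0 i)] =
  \prod_(i < n) lebesgue_measure (A i).
Proof.
elim: n A => [A _|n IH A mA].
  by rewrite big_ord0 /= diracE mem_set// => -[].
rewrite big_ord_recl/= /lebesgue_rV_step /pushforward.
rewrite -(IH (fun i => A (lift ord0 i)))//.
have mbox := measurable_rV_box (fun j => mA (lift ord0 j)).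
rewrite -product_measure1E//=; last exact: mA.
congr (product_measure1 _ _ _); apply/seteqP; split=> [p Ap|p [Ap0 Ap] i] /=.
  split=> [|i]; first by have := Ap ord0; rewrite rV_cons0.
  by have := Ap (lift ord0 i); rewrite rV_consS.
by case: (unliftP ord0 i) => [j|] ->; rewrite ?rV_consS ?rV_cons0//; exact: Ap.
Qed.

End lebesgue_rV.
Arguments lebesgue_rV {R} n.

Section kernel_sobolev.
Context (R : realType) (d : nat).
Local Notation Rd := 'rV[R]_d.
Local Notation mu := (lebesgue_rV d).
Implicit Types (K : Rd -> \bar R) (p : R) (Omega : set Rd) (u : Rd -> R).
Local Open Scope ereal_scope.

(* Measurability with respect to the completed sigma-algebra.  The library
   integral of a nonnegative function is a supremum over simple functions below
   it, hence it is the usual Lebesgue integral for such functions too, even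
   though [mu] only lives on the Borel sets. *)
Definition lebesgue_measurable_fun d' (T : measurableType d') (D : set Rd)
    (f : Rd -> T) : Prop :=
  @measurable_fun _ _ (g_sigma_algebraType (completed_algebra_gen mu)) T D f.

Definition norm2 (x : Rd) : R := Num.sqrt (\sum_(i < d) x ord0 i ^+ 2)%R.

Definition is_norm (N : Rd -> R) : Prop :=
  [/\ forall x y, (N (x + y) <= N x + N y)%R,
      forall (a : R) x, N (a *: x)%R = (`|a| * N x)%R &
      forall x, N x = 0%R -> x = 0%R].

(* Near each boundary point, in some orthonormal coordinate system (the columns
   of [A]), Omega is the strict epigraph, along the [i]-th axis, of a Lipschitz
   function of the other d - 1 coordinates. *)
Definition lipschitz_boundary Omega : Prop :=
  forall x0, (closure Omega `\` interior Omega) x0 ->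
  exists (A : 'M[R]_d) (i : 'I_d) (g : 'rV[R]_d.-1 -> R) (r : R),
    [/\ A *m A^T = 1%:M, lipschitz g, (0 < r)%R &
        forall y, (norm2 (y - x0) < r)%R ->
          (Omega y <-> (g (col' i (y *m A)) < (y *m A)%R ord0 i)%R)].

Definition kernel_on_Rd K : Prop :=
  [/\ lebesgue_measurable_fun setT K,
      forall x, 0 <= K x &
      ~ {ae mu, forall x, K x = 0}].

(* A function on Omega is represented by any extension of it to R^d. *)
Definition Lp_norm p Omega u : \bar R :=
  Lnorm mu p%:E ((EFin \o u) \_ Omega).

Definition Lp_space p Omega : set (Rd -> R) :=
  [set u | lebesgue_measurable_fun Omega u /\ Lp_norm p Omega u < +oo].

Definition WKp_seminorm K p Omega u : \bar R :=
  (\int[mu]_(y in Omega) \int[mu]_(x in Omega)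
     ((`|u x - u y| `^ p)%:E * K (x - y)%R)) `^ p^-1.

Definition WKp_space K p Omega : set (Rd -> R) :=
  [set u | Lp_space p Omega u /\ WKp_seminorm K p Omega u < +oo].

Definition WKp_norm K p Omega u : \bar R :=
  Lp_norm p Omega u + WKp_seminorm K p Omega u.

End kernel_sobolev.

(* Main.v *)
(** Let kap r be the supremum of K over the vectors of norm at least r.  Then
    c0 kap(|z|) <= K z <= kap(|z|), so K may be replaced by this nonincreasing
    radial kernel, which is Borel and not integrable near 0.

    At a scale rho, cover Omega by finitely many small balls around points x_i,
    cut the cover into disjoint pieces A_i, and use the Lipschitz boundary to
    find balls Q_i in Omega, of radius comparable to rho, at distance about
    3/4 rho of x_i.  Replacing v on A_i by the value of v at a well chosen point
    of Q_i costs, in L^p, at most rho^(-d) times the integral of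
    |v x - v y|^p over the pairs with rho/2 <= |x - y| < rho.  Summed over dyadic
    scales with the weights kap(rho) rho^d these costs are bounded by the
    seminorm, whereas the weights have infinite sum because kap is not
    integrable near 0; so each function in a bounded family has a scale at which
    the cost is as small as desired.  An ultrafilter on the indices fixes the
    scale and the limits of the finitely many values, and gives a subsequence
    that is Cauchy in L^p; Fatou's lemma handles the limit.  *)

Require Import Defs.
From HB Require Import structures.
From mathcomp Require Import all_boot all_order all_algebra.
From mathcomp Require Import all_classical all_reals all_analysis.
From mathcomp Require Import measurable_realfun.
From mathcomp Require Import ring lra.

Set Implicit Arguments.
Unset Strict Implicit.
Unset Printing Implicit Defensive.
Import Order.TTheory GRing.Theory Num.Def Num.Theory.
Import numFieldNormedType.Exports.

Local Open Scope classical_set_scope.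
Local Open Scope ring_scope.

(** * Monotonicity of integrals of nonnegative functions *)

Section nonmeasurable_integrals.
Local Open Scope ereal_scope.
Context d (T : measurableType d) (R : realType) (mu : {measure set T -> \bar R}).
Implicit Types (D : set T) (f g : T -> \bar R).

Import HBNNSimple.

(* The integral of a nonnegative function is a supremum over simple functions,
   and killing a simple function on a measurable null set does not change its
   integral; hence no measurability is needed. *)
Lemma ge0_ae_le_integral D f g :
  (forall x, D x -> 0 <= f x) -> (forall x, D x -> 0 <= g x) ->
  {ae mu, forall x, D x -> f x <= g x} ->
  \int[mu]_(x in D) f x <= \int[mu]_(x in D) g x.
Proof.
move=> f0 g0 [N [mN muN fgN]]; rewrite !ge0_integralE//.
apply: ge_ereal_sup => _ [h hf <-].
have mNC : measurable (~` N) by exact: measurableC.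
have -> : sintegral mu h = sintegral mu (proj_nnsfun h mNC).
  have mh : measurable_fun setT (EFin \o h) by exact/measurable_EFinP.
  rewrite -!integralT_nnsfun (ge0_negligible_integral mN)//; last first.
    by move=> x _; rewrite lee_fin.
  rewrite [RHS](ge0_negligible_integral mN)//; last 2 first.
    exact/measurable_EFinP.
    by move=> x _; rewrite lee_fin.
  apply: eq_integral => x; rewrite inE => -[_ Nx] /=.
  by rewrite mindicE mem_set// mulr1.
apply: ereal_sup_ubound; exists (proj_nnsfun h mNC) => //= x.
rewrite mindicE; case: (pselect (N x)) => Nx.
  rewrite memNset ?mulr0; last by move=> /(_ Nx).
  by rewrite erestrict_ge0.
rewrite mem_set// mulr1 (le_trans (hf x))//.
rewrite /patch; case: ifPn => //; rewrite inE => Dx.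
by apply: contrapT => fg; apply: Nx; apply: fgN => /= /(_ Dx).
Qed.

Lemma ge0_le_integral_nomeas D f g :
  (forall x, D x -> 0 <= f x) -> (forall x, D x -> f x <= g x) ->
  \int[mu]_(x in D) f x <= \int[mu]_(x in D) g x.
Proof.
move=> f0 fg; apply: ge0_ae_le_integral => //; last exact: aeW.
by move=> x Dx; exact: le_trans (f0 _ Dx) (fg _ Dx).
Qed.

End nonmeasurable_integrals.

(** * Borel representatives of Lebesgue measurable functions *)

Section borel_modification.
Context (R : realType) (d : nat).
Local Notation mu := (@lebesgue_rV R d).
Local Notation completed_measurable :=
  (@measurable _ (g_sigma_algebraType (completed_algebra_gen mu))).

(** The sets with this property form a sigma-algebra containing every union of a Borel set and a
    negligible set: a complement keeps the same [N], a countable union takes the union of the null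
    sets. *)
Lemma completed_measurable_modulo_null (A : set 'rV[R]_d) :
  completed_measurable A ->
  exists N, [/\ measurable N, mu N = 0%E & measurable (A `\` N)].
Proof.
move: A; suff : completed_measurable `<=`
    [set A | exists N, [/\ measurable N, mu N = 0%E & measurable (A `\` N)]].
  by move=> h A /h.
apply: smallest_sub; last first.
  move=> _ [A mA [N' [N [mN muN N'N]] <-]]; exists N; split=> //.
  rewrite setDUl (_ : N' `\` N = set0) ?setU0; last by rewrite setD_eq0.
  exact: measurableD.
split=> /=.
- by exists set0; rewrite set0D.
- move=> A [N [mN muN mAN]]; exists N; split=> //.
  rewrite setTD (_ : ~` A `\` N = ~` N `\` (A `\` N)).
    by apply: measurableD => //; exact: measurableC.
  apply/seteqP; split=> x [/=].
    by move=> Ax Nx; split=> // -[].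
  by move=> Nx ANx; split=> // Ax; apply: ANx.
- move=> A /choice[N hN]; exists (\bigcup_i N i); split.
  + by apply: bigcupT_measurable => i; have [] := hN i.
  + apply: measure_negligible.
      by apply: bigcupT_measurable => i; have [] := hN i.
    by apply: negligible_bigcup => i; have [? ? _] := hN i; apply/negligibleP.
  + rewrite (_ : _ `\` _ = \bigcup_i (A i `\` N i) `\` \bigcup_i N i).
      apply: measurableD; apply: bigcupT_measurable => i;
        by have [] := hN i.
    apply/seteqP; split=> x [[i _ Ax] Nx]; split=> //.
      by exists i => //; split=> // Nix; apply: Nx; exists i.
    by exists i => //; case: Ax.
Qed.

(** Measurability is decided by the superlevel sets at rational heights. Each of these is Borel off
    a null set, so all of them are Borel off the union [NN] of countably many null sets, and [u] is
    set to 0 on [NN] and off [Omega]. *)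
Lemma borel_modification (Omega : set 'rV[R]_d) (u : 'rV[R]_d -> R) :
  measurable Omega -> lebesgue_measurable_fun Omega u ->
  exists v : 'rV[R]_d -> R, [/\ measurable_fun setT v,
    forall x, ~ Omega x -> v x = 0 &
    {ae mu, forall x, Omega x -> u x = v x}].
Proof.
move=> mO mu_.
have mO' : completed_measurable Omega.
  apply: sub_sigma_algebra; exists Omega => //.
  by exists set0; [exact: negligible_set0|rewrite setU0].
pose A (q : rat) := Omega `&` u @^-1` `]ratr q, +oo[.
have /choice[N hN] (q : rat) :
    exists N, [/\ measurable N, mu N = 0%E & measurable (A q `\` N)].
  apply: completed_measurable_modulo_null.
  by apply: (mu_ mO'); exact: measurable_itv.
pose NN := \bigcup_n N (odflt 0 (unpickle n)).
have NNE q : N q `<=` NN by move=> x Nx; exists (pickle q) => //; rewrite pickleK.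
have mNN : measurable NN.
  by apply: bigcupT_measurable => q; have [] := hN (odflt 0 (unpickle q)).
have muNN : mu NN = 0%E.
  apply: measure_negligible => //; apply: negligible_bigcup => n.
  by have [? ? _] := hN (odflt 0 (unpickle n)); apply/negligibleP.
pose v := u \_ (Omega `\` NN).
exists v; split.
- apply/(measurable_restrictT _ _).1; first exact: measurableD.
  apply: (measurability _ (RGenOInfty.measurableE R)).
  move=> _ [_ [r ->] <-].
  rewrite (_ : _ `&` _ = (\bigcup_(q in [set q : rat | r < ratr q]) (A q `\` N q))
      `\` NN).
    apply: measurableD => //; rewrite bigcup_mkcond.
    apply: bigcupT_measurable_rat => q; case: ifPn => // _.
    by have [] := hN q.
  apply/seteqP; split=> x /=.
    rewrite in_itv/= andbT => -[[Ox Nx] ru]; split=> //.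
    have [q] := rat_in_itvoo ru; rewrite in_itv/= => /andP[rq qu].
    exists q => //; split; last by move=> Nq; apply: Nx; exact: NNE Nq.
    by split=> //=; rewrite in_itv/= qu.
  move=> [[q /= rq [[Ox]]]]; rewrite /= !in_itv/= !andbT => qu _ Nx.
  by split=> //; exact: lt_trans qu.
- by move=> x Ox; rewrite /v /patch ifN// notin_setE => -[].
- exists NN; split=> //.
  move=> x /= h; apply: contrapT => Nx; apply: h => Ox.
  by rewrite /v /patch ifT// inE.
Qed.

Lemma borel_lebesgue_measurable (D : set 'rV[R]_d) (u : 'rV[R]_d -> R) :
  measurable D -> measurable_fun D u -> lebesgue_measurable_fun D u.
Proof.
move=> mD mu_ _ Y mY; apply: sub_sigma_algebra.
exists (D `&` u @^-1` Y); first exact: mu_.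
by exists set0; [exact: negligible_set0|rewrite setU0].
Qed.

End borel_modification.

(** * Norms on R^d and their equivalence with the sup norm *)

Section norms_on_rV.
Context (R : realType) (d : nat).
Implicit Types x y z : 'rV[R]_d.

Lemma ler_coord_norm x i : `|x ord0 i| <= `|x|.
Proof.
by rewrite [leRHS]/normr /= mx_normrE; apply/bigmax_geP; right; exists (ord0, i).
Qed.

Lemma rV_norm_leP x (c : R) : 0 <= c ->
  (forall i, `|x ord0 i| <= c) <-> `|x| <= c.
Proof.
move=> c0; split=> [xc|xc i]; last exact: le_trans (ler_coord_norm x i) xc.
rewrite [leLHS]/normr /= mx_normrE; apply/bigmax_leP; split=> // -[i j] _ /=.
by rewrite ord1.
Qed.

Context (nrm : 'rV[R]_d -> R) (nrm_norm : is_norm nrm).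

Let nrmD x y : nrm (x + y) <= nrm x + nrm y.
Proof. by have [] := nrm_norm. Qed.

Let nrmZ (a : R) x : nrm (a *: x) = `|a| * nrm x.
Proof. by have [] := nrm_norm. Qed.

Lemma is_norm0 : nrm 0 = 0.
Proof. by have := nrmZ 0 0; rewrite scale0r normr0 mul0r. Qed.

Lemma is_normN x : nrm (- x) = nrm x.
Proof. by have := nrmZ (-1) x; rewrite scaleN1r normrN1 mul1r. Qed.

Lemma is_norm_ge0 x : 0 <= nrm x.
Proof.
have := nrmD x (- x); rewrite subrr is_norm0 is_normN.
by rewrite -mulr2n pmulrn_lge0.
Qed.

Lemma is_normBC x y : nrm (x - y) = nrm (y - x).
Proof. by rewrite -is_normN opprB. Qed.

Lemma is_norm_triangle y x z : nrm (x - z) <= nrm (x - y) + nrm (y - z).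
Proof. by have := nrmD (x - y) (y - z); rewrite addrA subrK. Qed.

Lemma is_norm_gt0 x : x != 0 -> 0 < nrm x.
Proof.
move=> x0; rewrite lt_neqAle is_norm_ge0 andbT eq_sym; apply: contra x0.
by move=> /eqP nx0; apply/eqP; have [_ _] := nrm_norm; exact.
Qed.

Lemma is_norm_bounded : exists2 C, 0 < C & forall x, nrm x <= C * `|x|.
Proof.
exists (1 + \sum_(j < d) nrm (delta_mx 0 j)).
  by rewrite ltr_pwDl// sumr_ge0// => j _; exact: is_norm_ge0.
move=> x; rewrite mulrDl mul1r (@le_trans _ _ (\sum_(j < d) nrm (delta_mx 0 j) * `|x|))//.
  rewrite {1}[x]row_sum_delta.
  elim/big_rec2 : _ => [|j y1 y2 _ ih]; first by rewrite is_norm0.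
  by rewrite (le_trans (nrmD _ _))// lerD// nrmZ mulrC ler_wpM2l ?is_norm_ge0// ler_coord_norm.
by rewrite mulr_suml lerDr.
Qed.

Lemma is_norm_continuous : continuous nrm.
Proof.
have [C C0 nrmC] := is_norm_bounded.
move=> x; apply/(@cvgrPdist_lt _ _ _ (nbhs x) (nbhs_filter x)) => e e0.
apply/nbhs_ballP; exists (e / C) => [|y]; first exact: divr_gt0.
rewrite -ball_normE /= ltr_pdivlMr// mulrC => xy.
apply: le_lt_trans xy; apply: le_trans (nrmC _).
rewrite ler_distl; apply/andP; split.
  by rewrite lerBlDr addrC is_normBC; have := nrmD (y - x) x; rewrite subrK.
by rewrite addrC; have := nrmD (x - y) y; rewrite subrK.
Qed.

(** The lower bound comes from the minimum of [nrm] on the unit sphere of the sup norm, which is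
    compact. *)
Lemma is_norm_equiv : exists2 C, 0 < C &
  forall x, nrm x <= C * `|x| /\ `|x| <= C * nrm x.
Proof.
have [C C0 nrmC] := is_norm_bounded.
(* An empty sphere, as in dimension 0, forces every vector to be 0. *)
have [S0|/set0P S0] := eqVneq [set x : 'rV[R]_d | `|x| = 1] set0.
  exists C => // x; split=> //.
  have [->|x0] := eqVneq x 0; first by rewrite normr0 mulr_ge0 ?is_norm_ge0// ltW.
  suff : set0 (`|x|^-1 *: x) by [].
  by rewrite -S0 /= normrZ normfV normr_id mulVf// normr_eq0.
have cS : compact [set x : 'rV[R]_d | `|x| = 1].
  apply: bounded_closed_compact.
    by exists 1; split=> // y y1 x /= ->; exact: ltW.
  apply: (@closed_comp _ _ (fun x : 'rV[R]_d => `|x|) [set t | t = 1]).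
    by move=> x _; exact: norm_continuous.
  exact: closed_eq.
have [x0 x01 x0min] : exists2 x0, `|x0| = 1 & forall x, `|x| = 1 -> nrm x0 <= nrm x.
  have [|c] := @EVT_min_rV R d nrm _ S0 cS.
    exact/continuous_subspaceT/is_norm_continuous.
  rewrite inE => c1 cmin; exists c => // x x1.
  by apply: cmin; rewrite inE.
have nx0 : 0 < nrm x0.
  by apply: is_norm_gt0; rewrite -normr_eq0 x01 oner_eq0.
exists (Num.max C (nrm x0)^-1) => [|x]; first by rewrite lt_max C0.
split; first by rewrite (le_trans (nrmC x))// ler_wpM2r// le_max lexx.
have [->|xN0] := eqVneq x 0.
  by rewrite normr0 mulr_ge0 ?is_norm_ge0// le_max ltW.
rewrite (@le_trans _ _ ((nrm x0)^-1 * nrm x))//; last first.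
  by rewrite ler_wpM2r ?is_norm_ge0// le_max lexx orbT.
rewrite mulrC ler_pdivlMr// mulrC.
have xg : 0 < `|x| by rewrite normr_gt0.
have := x0min (`|x|^-1 *: x); rewrite normrZ normfV normr_id mulVf ?gt_eqF// => /(_ erefl).
by rewrite nrmZ normfV normr_id [leRHS]mulrC ler_pdivlMr.
Qed.

Lemma is_norm_open_ball x (r : R) : open [set y | nrm (y - x) < r].
Proof.
apply: (@open_comp _ _ (fun y => nrm (y - x)) [set t | t < r]); last exact: open_lt.
move=> y _; apply: continuous_comp; last exact: is_norm_continuous.
by apply: continuousB => //; exact: cst_continuous.
Qed.

End norms_on_rV.

(** * Interior corkscrew condition for Lipschitz domains *)

Section corkscrew.
Context (R : realType).

Lemma norm2_le_norm d (x : 'rV[R]_d) : norm2 x <= Num.sqrt d%:R * `|x|.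
Proof.
rewrite -[`|x|]normr_id -sqrtr_sqr -sqrtrM// ler_wsqrtr//.
rewrite (@le_trans _ _ (\sum_(i < d) `|x| ^+ 2))//.
  apply: ler_sum => i _; rewrite -real_normK ?num_real//.
  by rewrite lerXn2r ?nnegrE// ler_coord_norm.
by rewrite sumr_const card_ord mulr_natl.
Qed.

Lemma norm_le_norm2 d (x : 'rV[R]_d) : `|x| <= norm2 x.
Proof.
apply/rV_norm_leP => [|i]; first exact: sqrtr_ge0.
rewrite -sqrtr_sqr ler_wsqrtr// (bigD1 i)//= lerDl sumr_ge0// => j _.
exact: sqr_ge0.
Qed.

Lemma mulmx_bounded d (A : 'M[R]_d) : exists2 C, 0 < C &
  forall w : 'rV[R]_d, `|w *m A| <= C * `|w|.
Proof.
exists (1 + \sum_i \sum_j `|A i j|).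
  by rewrite ltr_pwDl// sumr_ge0// => i _; rewrite sumr_ge0.
move=> w; apply/rV_norm_leP => [|j].
  by rewrite mulr_ge0// addr_ge0// sumr_ge0// => i _; rewrite sumr_ge0.
rewrite mxE (le_trans (ler_norm_sum _ _ _))// mulrDl mul1r.
apply: (@le_trans _ _ ((\sum_i \sum_j `|A i j|) * `|w|)); last by rewrite lerDr.
rewrite mulr_suml ler_sum// => i _; rewrite normrM mulrC.
rewrite ler_pM ?ler_coord_norm// (bigD1 j)//= lerDl sumr_ge0//.
Qed.

Lemma norm_col' d (i : 'I_d) (w : 'rV[R]_d) : `|col' i w| <= `|w|.
Proof. by apply/rV_norm_leP => // j; rewrite mxE ler_coord_norm. Qed.

Lemma bounded_closure d (A : set 'rV[R]_d) : bounded_set A -> bounded_set (closure A).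
Proof.
move=> [M0 [M0r OM0]]; exists M0; split=> // M /OM0 OM x clx.
have cM : closed [set y : 'rV[R]_d | `|y| <= M].
  apply: (@closed_comp _ _ (fun y : 'rV[R]_d => `|y|) [set t | t <= M]).
    by move=> y _; exact: norm_continuous.
  exact: closed_le.
by have := closureS (OM : A `<=` [set y | `|y| <= M]) clx; rewrite -((closure_id _).1 cM).
Qed.

Context (d : nat) (nrm : 'rV[R]_d -> R) (nrm_norm : is_norm nrm).
Context (Omega : set 'rV[R]_d).

(** One parameter is both the range of scales and the relative radius, which makes the condition
    monotone in [eta]. The centre lies at distance exactly [rho], so that the ball can later be
    fitted into an annulus around [x]. *)
Definition corkscrew (eta : R) (x : 'rV[R]_d) :=
  forall rho, 0 < rho -> rho < eta -> exists2 y, nrm (y - x) = rho &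
    forall z, nrm (z - y) < eta * rho -> Omega z.

Lemma corkscrew_le eta eta' x : eta' <= eta -> corkscrew eta x -> corkscrew eta' x.
Proof.
move=> le_eta cx rho rho0 rhoeta; have [|y yx yO] := cx rho rho0.
  exact: lt_le_trans le_eta.
by exists y => // z zy; apply: yO; rewrite (lt_le_trans zy)// ler_wpM2r// ltW.
Qed.

Lemma is_norm_direction (e : 'rV[R]_d) (x : 'rV[R]_d) rho : e != 0 -> 0 < rho ->
  nrm (x + (rho / nrm e) *: e - x) = rho.
Proof.
move=> e0 rho0; have ne0 := is_norm_gt0 nrm_norm e0.
rewrite addrAC subrr add0r; have [_ -> _] := nrm_norm.
by rewrite ger0_norm ?divr_ge0 ?ltW// divfK// gt_eqF.
Qed.

Lemma corkscrew_interior x0 : (0 < d)%N -> open Omega -> Omega x0 ->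
  exists delta eta, [/\ 0 < delta, 0 < eta &
    forall x, `|x - x0| < delta -> corkscrew eta x].
Proof.
move=> d0 oO Ox0; have [C C0 nrmC] := is_norm_equiv nrm_norm.
have /nbhs_ballP[r /= r0 rO] : nbhs x0 Omega by exact: open_nbhs_nbhs.
have e0 : const_mx 1 != 0 :> 'rV[R]_d.
  apply/eqP => /rowP/(_ (Ordinal d0)); rewrite !mxE => /eqP.
  by rewrite oner_eq0.
(* Both [z - y] and [y - x] have sup norm at most [C * rho < r / 4]; with [x - x0] below [r / 2]
   this keeps [z] within [r] of [x0]. *)
exists (r / 2), (minr 1 (r / (4 * C))); split.
- by rewrite divr_gt0.
- by rewrite lt_min ltr01 divr_gt0// mulr_gt0.
move=> x xx0 rho rho0; rewrite lt_min => /andP[rho1 rhor].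
exists (x + (rho / nrm (const_mx 1)) *: const_mx 1).
  exact: is_norm_direction.
set y := x + _ => z zy; apply: rO; rewrite -ball_normE /= distrC.
have yx : nrm (y - x) = rho by exact: is_norm_direction.
have zy' : nrm (z - y) < rho.
  by rewrite (lt_le_trans zy)// ler_piMl ?(ltW rho0)// ge_min lexx.
rewrite ltr_pdivlMr ?mulr_gt0// in rhor.
have h1 : `|z - y| <= C * rho.
  by apply: le_trans (nrmC _).2 _; rewrite ler_pM2l// ltW.
have h2 : `|y - x| <= C * rho by rewrite -[in leRHS]yx; exact: (nrmC _).2.
have -> : z - x0 = (z - y) + (y - x) + (x - x0) by rewrite subrKA subrKA.
have h3 := ler_normD (z - y + (y - x)) (x - x0).
have h4 := ler_normD (z - y) (y - x).
lra.
Qed.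

(** The centre [y] lies above [x] along the axis of the chart: moving up by [s] gains height [s] and
    leaves the value of [g] unchanged. A further displacement [w] costs at most [(M + 1) * |w|] in
    height above the graph, and [eta] is so small that this is at most [s]. *)
Lemma corkscrew_boundary x0 : lipschitz_boundary Omega ->
  (closure Omega `\` interior Omega) x0 ->
  exists delta eta, [/\ 0 < delta, 0 < eta &
    forall x, `|x - x0| < delta -> Omega x -> corkscrew eta x].
Proof.
move=> /[apply] -[A [i [g [r [AAT lipg r0 chart]]]]].
have [C C0 nrmC] := is_norm_equiv nrm_norm.
have [B B0 AB] := mulmx_bounded A.
have [M M0 gM] : exists2 M, 0 < M & forall a b, `|g a - g b| <= M * `|a - b|.
  have [M0 [_ lipM]] := lipg; exists (Num.max M0 0 + 1).
    by rewrite ltr_pwDr// le_max lexx orbT.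
  move=> a b; apply: (lipM (Num.max M0 0 + 1) _ (a, b)) => //=.
  by rewrite (@le_lt_trans _ _ (Num.max M0 0)) ?ltrDl// le_max lexx.
pose D := 1 + Num.sqrt d%:R : R.
have D0 : 0 < D by rewrite /D ltr_pwDl// sqrtr_ge0.
have norm2D (v : 'rV[R]_d) : norm2 v <= D * `|v|.
  by rewrite (le_trans (norm2_le_norm v))// ler_wpM2r// lerDr.
(* [A] is orthogonal, so [e] is the vertical axis of the chart in the original coordinates. *)
pose e : 'rV[R]_d := delta_mx 0 i *m A^T.
have eA : e *m A = delta_mx 0 i by rewrite -mulmxA (mulmx1C AAT) mulmx1.
have e0 : e != 0.
  apply/eqP => e0; move: eA; rewrite e0 mul0mx => /rowP/(_ i) /eqP.
  by rewrite !mxE !eqxx eq_sym oner_eq0.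
have ne0 := is_norm_gt0 nrm_norm e0.
(* [P] is such that [(M + 1) * B * C * (P^-1 * rho)] equals [rho / nrm e], the gain [s] in
   height. *)
pose P := (M + 1) * (B * C) * nrm e.
have P0 : 0 < P by rewrite !mulr_gt0// addr_gt0.
(* These radii leave half of the chart radius [r] to [x - x0] and half to [z - x], after [norm2] is
   bounded by [D] times the sup norm. *)
exists (r / (2 * D)), (minr (minr 1 (r / (4 * C * D))) P^-1); split.
- by rewrite divr_gt0// mulr_gt0.
- by rewrite !lt_min ltr01 invr_gt0 P0 divr_gt0// !mulr_gt0.
move=> x xx0 Ox rho rho0; rewrite !lt_min -andbA => /and3P[rho1 rhor _].
pose s := rho / nrm e; have s0 : 0 < s by rewrite divr_gt0.
exists (x + s *: e); first exact: is_norm_direction.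
set y := x + _ => z zy.
have yx : nrm (y - x) = rho by exact: is_norm_direction.
have zy1 : nrm (z - y) < rho.
  by rewrite (lt_le_trans zy)// ler_piMl ?(ltW rho0)// !ge_min lexx.
have zy2 : nrm (z - y) < P^-1 * rho.
  by rewrite (lt_le_trans zy)// ler_wpM2r ?(ltW rho0)// !ge_min lexx !orbT.
rewrite ltr_pdivlMr ?mulr_gt0// in rhor.
rewrite ltr_pdivlMr ?mulr_gt0// in xx0.
have h1 : `|z - y| <= C * rho.
  by apply: le_trans (nrmC _).2 _; rewrite ler_pM2l// ltW.
have h2 : `|y - x| <= C * rho by rewrite -[in leRHS]yx; exact: (nrmC _).2.
have inchart v : `|v - x0| * D < r -> norm2 (v - x0) < r.
  by move=> ?; rewrite (le_lt_trans (norm2D _))// mulrC.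
have zchart : norm2 (z - x0) < r.
  apply: inchart.
  have -> : z - x0 = (z - y) + (y - x) + (x - x0) by rewrite subrKA subrKA.
  have h3 := ler_normD (z - y + (y - x)) (x - x0).
  have h4 := ler_normD (z - y) (y - x).
  apply: (@le_lt_trans _ _ ((C * rho + C * rho + `|x - x0|) * D)).
    by rewrite ler_pM2r//; lra.
  by lra.
have xchart : norm2 (x - x0) < r.
  by apply: inchart; lra.
apply/(chart _ zchart).
pose w := (z - y) *m A.
have wP : (M + 1) * `|w| <= s.
  have : `|w| <= B * (C * (P^-1 * rho)).
    rewrite (le_trans (AB _))// ler_pM2l// (le_trans (nrmC _).2)// ler_pM2l//.
    exact: ltW.
  rewrite -(@ler_pM2l _ (M + 1)) ?addr_gt0// => /le_trans; apply.
  rewrite le_eqVlt; apply/orP; left; apply/eqP.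
  rewrite /s /P; field.
  by rewrite !gt_eqF//= addr_gt0.
have zA : z *m A = x *m A + s *: delta_mx 0 i + w.
  by rewrite /w mulmxBl /y mulmxDl -scalemxAl eA addrC subrK.
have gz : g (col' i (z *m A)) <= g (col' i (x *m A)) + M * `|w|.
  have := gM (col' i (z *m A)) (col' i (x *m A)).
  rewrite ler_distl => /andP[_] /le_trans; apply.
  rewrite lerD2l ler_pM2l//.
  have -> : col' i (z *m A) - col' i (x *m A) = col' i w.
    apply/rowP => j; rewrite zA !mxE eqxx /= eq_sym.
    by rewrite (negbTE (neq_lift _ _)) mulr0 addr0 addrAC subrr add0r.
  exact: norm_col'.
have wi : - `|w| <= w ord0 i.
  by have := ler_coord_norm w i; rewrite ler_norml => /andP[].
have zi : (z *m A) ord0 i = (x *m A) ord0 i + s + w ord0 i.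
  by rewrite zA !mxE !eqxx mulr1.
have := (chart _ xchart).1 Ox; rewrite zi.
by lra.
Qed.

(** Around each point of the closure the condition holds for all small [eta], by monotonicity;
    compactness of the closure makes [eta] common to all points. *)
Lemma uniform_corkscrew : (0 < d)%N -> open Omega -> bounded_set Omega ->
  lipschitz_boundary Omega ->
  exists2 eta, 0 < eta & forall x, Omega x -> corkscrew eta x.
Proof.
move=> d0 oO bO lO.
have cO : compact (closure Omega).
  apply: bounded_closed_compact; last exact: closed_closure.
  exact: bounded_closure.
have : \forall eta \near 0^'+,
    closure Omega `<=` (fun x => Omega x -> corkscrew eta x).
  apply: ((compact_near_coveringP _).1 cO) => x0 clx0.
  have [delta [eta [delta0 eta0 h]]] : exists delta eta, [/\ 0 < delta, 0 < eta &
      forall x, `|x - x0| < delta -> Omega x -> corkscrew eta x].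
    have [Ox0|nOx0] := pselect (Omega x0).
      have [delta [eta [? ? h]]] := corkscrew_interior d0 oO Ox0.
      by exists delta, eta; split=> // x xx0 _; exact: h.
    by apply: corkscrew_boundary => //; split=> // /interior_subset.
  have hx0 : nbhs x0 [set x | `|x - x0| < delta].
    by apply/nbhs_ballP; exists delta => //= x; rewrite -ball_normE /= distrC.
  near=> x eta' => /= Ox.
  apply: (@corkscrew_le eta); first by near: eta'; exact: nbhs_right_le.
  by apply: h => //; near: x.
move=> h.
near (0 : R)^'+ => eta.
exists eta; first by near: eta; exact: nbhs_right_gt.
move=> x Ox; apply: (near h eta) => //; exact: subset_closure.
Unshelve. all: by end_near. Qed.

End corkscrew.

(** * Measurability of the integrands and of partial integrals *)

Section measurability.
Context (R : realType) (d : nat).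
Local Notation mu := (@lebesgue_rV R d).
Local Open Scope ereal_scope.

Lemma continuous_measurable_rV (f : 'rV[R]_d -> R) :
  continuous f -> measurable_fun setT f.
Proof.
move=> cf; apply: (measurability _ (RGenOpens.measurableE R)) => _ [_ [a [b ->]] <-].
rewrite setTI; apply: open_measurable_rV; apply: open_comp => [x _|].
  exact: cf.
exact: interval_open.
Qed.

Lemma measurable_rVB :
  measurable_fun setT (fun xy : 'rV[R]_d * 'rV[R]_d => (xy.1 - xy.2)%R).
Proof.
apply: measurable_fun_rVP => i.
under eq_fun do rewrite !mxE.
apply: measurable_funB.
  exact: (measurableT_comp (measurable_coord i) measurable_fst).
exact: (measurableT_comp (measurable_coord i) measurable_snd).
Qed.

Lemma nonincreasing_measurable_ereal (f : R -> \bar R) :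
  (forall r s, (r <= s)%R -> f s <= f r) -> measurable_fun setT f.
Proof.
move=> nif; apply: (measurability _ (ErealGenOInfty.measurableE R)) => _ [_ [r ->] <-].
rewrite setTI; apply: is_interval_measurable => s t _ /= + z /andP[_ zt].
by rewrite !in_itv/= !andbT => /lt_le_trans; apply; exact: nif.
Qed.

(** Extending [f] by 0 off the strip over [D] reduces the claim to Tonelli's theorem on the whole
    product. *)
Lemma measurable_partial_integral d1 d2 (T1 : measurableType d1)
    (T2 : measurableType d2) (m : {sigma_finite_measure set T1 -> \bar R})
    (D : set T1) (f : T1 * T2 -> \bar R) : measurable D ->
  measurable_fun setT f -> (forall z, 0 <= f z) ->
  measurable_fun setT (fun y => \int[m]_(x in D) f (x, y)).
Proof.
move=> mD mf f0.
pose f' := f \_ (D `*` setT).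
have mf' : measurable_fun setT f'.
  apply/(measurable_restrictT _ _).1; first exact: measurableX.
  exact: measurable_funTS.
have f'0 z : 0 <= f' z by rewrite erestrict_ge0.
have := measurable_fun_fubini_tonelli_G f' mf' f'0 (m1 := m).
apply: eq_measurable_fun => y _; rewrite integral_mkcond.
apply: eq_integral => x _; rewrite /f' /patch; congr (if _ then _ else _).
by apply/idP/idP; rewrite !inE/= => // -[].
Qed.

Context (nrm : 'rV[R]_d -> R) (nrm_norm : is_norm nrm).

(** The integrand of the seminorm with a radial weight [g] in place of [K]; [g] will be the radial
    profile, the indicator of an annulus, or a combination of these. *)
Definition radial_pdiff (p : R) (g : R -> \bar R) (v : 'rV[R]_d -> R)
    (x y : 'rV[R]_d) : \bar R :=
  (`|v x - v y| `^ p)%:E * g (nrm (x - y)).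

Lemma measurable_pdiff p (v : 'rV[R]_d -> R) c : measurable_fun setT v ->
  measurable_fun setT (fun x => (`|v x - c| `^ p)%:E).
Proof.
move=> mv; apply/measurable_EFinP.
suff mB : measurable_fun setT (fun x => `|v x - c|%R).
  exact: (measurableT_comp (measurable_powR p) mB).
by apply: measurableT_comp => //; exact: measurable_funB.
Qed.

Lemma measurable_radial_pdiff p g v : measurable_fun setT g ->
  measurable_fun setT v ->
  measurable_fun setT (fun z : 'rV[R]_d * 'rV[R]_d => radial_pdiff p g v z.1 z.2).
Proof.
move=> mg mv; apply: emeasurable_funM.
  apply/measurable_EFinP.
  suff mB : measurable_fun setT
      (fun z : 'rV[R]_d * 'rV[R]_d => `|v z.1 - v z.2|%R).
    exact: (measurableT_comp (measurable_powR p) mB).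
  apply: measurableT_comp => //; apply: measurable_funB.
    exact: (measurableT_comp mv measurable_fst).
  exact: (measurableT_comp mv measurable_snd).
apply: (measurableT_comp mg).
apply: (measurableT_comp _ measurable_rVB).
by apply: continuous_measurable_rV; exact: is_norm_continuous.
Qed.

Lemma radial_pdiff_ge0 p g v x y : (forall r, 0 <= g r) -> 0 <= radial_pdiff p g v x y.
Proof. by move=> g0; rewrite mule_ge0 ?lee_fin ?powR_ge0. Qed.

Lemma measurable_radial_pdiff1 p g v y : measurable_fun setT g ->
  measurable_fun setT v -> measurable_fun setT (radial_pdiff p g v ^~ y).
Proof.
move=> mg mv.
exact: (measurableT_comp (measurable_radial_pdiff p mg mv) (measurable_pair2 y)).
Qed.

Lemma measurable_integral_radial_pdiff p g v (D : set 'rV[R]_d) : measurable D ->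
  (forall r, 0 <= g r) -> measurable_fun setT g -> measurable_fun setT v ->
  measurable_fun setT (fun y => \int[mu]_(x in D) radial_pdiff p g v x y).
Proof.
move=> mD g0 mg mv; apply: (@measurable_partial_integral _ _ _ _ mu D
  (fun z => radial_pdiff p g v z.1 z.2)) => //.
  exact: measurable_radial_pdiff.
by move=> z; exact: radial_pdiff_ge0.
Qed.

End measurability.

(** * Radial majorant of the kernel *)

Section radial_profile.
Context (R : realType) (d : nat) (nrm : 'rV[R]_d -> R) (K : 'rV[R]_d -> \bar R).
Hypothesis K_ge0 : forall x, (0 <= K x)%E.
Local Open Scope ereal_scope.

(* The least radially nonincreasing majorant of K, as a function of the norm;
   0 is thrown in for the case when no vector has norm at least r. *)
Definition radial_profile (r : R) : \bar R :=
  ereal_sup (0 |` [set K w | w in [set w | (r <= nrm w)%R]]).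

Lemma radial_profile_ge0 r : 0 <= radial_profile r.
Proof. by apply: ereal_sup_ubound; left. Qed.

Lemma radial_profile_nonincreasing r s : (r <= s)%R ->
  radial_profile s <= radial_profile r.
Proof.
move=> rs; apply: ereal_sup_le => _ [->|[w /= sw <-]]; first by left.
by right; exists w => //=; exact: le_trans sw.
Qed.

Lemma radial_profile_ge z : K z <= radial_profile (nrm z).
Proof. by apply: ereal_sup_ubound; right; exists z => /=. Qed.

Lemma radial_profile_le (c0 : R) z : (0 < c0)%R ->
  (forall x y, (nrm x <= nrm y)%R -> c0%:E * K y <= K x) ->
  c0%:E * radial_profile (nrm z) <= K z.
Proof.
move=> c00 Kdec; rewrite muleC -lee_pdivlMr//.
apply: ge_ereal_sup => _ [->|[w /= zw <-]].
  by rewrite mule_ge0// lee_fin invr_ge0 ltW.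
by rewrite lee_pdivlMr// muleC; exact: Kdec.
Qed.

Lemma measurable_radial_profile : measurable_fun setT radial_profile.
Proof.
by apply: nonincreasing_measurable_ereal => r s; exact: radial_profile_nonincreasing.
Qed.

End radial_profile.

(** The sum is at most three times its largest term, whose [p]-th power is one of the three on the
    right. *)
Lemma powRD3_le (R : realType) (p a b c : R) : 0 <= p -> 0 <= a -> 0 <= b -> 0 <= c ->
  (a + b + c) `^ p <= 3 `^ p * (a `^ p + b `^ p + c `^ p).
Proof.
move=> p0 a0 b0 c0; pose m := Num.max (Num.max a b) c.
have am : a <= m by rewrite !le_max lexx.
have bm : b <= m by rewrite !le_max lexx orbT.
have cm : c <= m by rewrite !le_max lexx orbT.
rewrite (@le_trans _ _ ((3 * m) `^ p))//.
  by rewrite ge0_ler_powR// ?nnegrE ?addr_ge0//; lra.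
rewrite powRM//; last exact: le_trans am.
rewrite ler_wpM2l ?powR_ge0// /m /Num.max; case: ifPn => _; last first.
  by case: ifPn => _; rewrite -?addrA ?lerDl ?addr_ge0 ?powR_ge0//
    addrCA lerDl addr_ge0 ?powR_ge0.
by rewrite lerDr addr_ge0 ?powR_ge0.
Qed.

(** * Averages and finite partitions *)

Section average.
Local Open Scope ereal_scope.
Context d (T : measurableType d) (R : realType) (mu : {measure set T -> \bar R}).

Lemma exists_le_average (Q : set T) (f : T -> \bar R) (q t : R) :
  measurable Q -> (forall x, Q x -> 0 <= f x) -> (0 <= t)%R -> q%:E <= mu Q ->
  \int[mu]_(x in Q) f x < (t * q)%:E -> exists2 y, Q y & f y < t%:E.
Proof.
move=> mQ f0 t0 qQ; apply: contraPP => /forall2NP noy; apply/negP; rewrite -leNgt.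
have tf y : Q y -> t%:E <= f y.
  by move=> Qy; case: (noy y) => // /negP; rewrite -leNgt.
apply: (@le_trans _ _ (\int[mu]_(x in Q) cst t%:E x)).
  by rewrite integral_cst// EFinM lee_wpmul2l// lee_fin.
by apply: ge0_le_integral_nomeas => // x Qx; rewrite lee_fin.
Qed.

Lemma ge0_integral_partition n (D : set T) (A : nat -> set T) (f : T -> \bar R) :
  (forall i, measurable (A i)) -> trivIset setT A ->
  D = \big[setU/set0]_(i < n) A i ->
  measurable_fun setT f -> (forall x, 0 <= f x) ->
  \int[mu]_(x in D) f x = \sum_(i < n) \int[mu]_(x in A i) f x.
Proof.
move=> mA tA -> mf f0; rewrite -(big_mkord xpredT A) ge0_integral_bigsetU//.
- by rewrite big_mkord.
- exact: iota_uniq.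
- exact: sub_trivIset tA.
- exact: measurable_funTS.
Qed.

End average.

(** * Approximation by step functions at one scale *)

Section approximation.
Context (R : realType) (d : nat).
Local Notation mu := (@lebesgue_rV R d).
Context (nrm : 'rV[R]_d -> R) (nrm_norm : is_norm nrm).
Context (p : R) (p_gt0 : 0 < p) (Omega : set 'rV[R]_d) (mOmega : measurable Omega).
Context (n : nat) (A Q : nat -> set 'rV[R]_d) (q : R) (g : R -> \bar R).
Hypothesis mA : forall i, measurable (A i).
Hypothesis tA : trivIset setT A.
Hypothesis OmegaA : Omega = \big[setU/set0]_(i < n) A i.
Hypothesis mQ : forall i, measurable (Q i).
Hypothesis QOmega : forall i, (i < n)%N -> Q i `<=` Omega.
Hypothesis q_gt0 : 0 < q.
Hypothesis qQ : forall i, (i < n)%N -> (q%:E <= mu (Q i))%E.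
Hypothesis mg : measurable_fun setT g.
Hypothesis g_ge0 : forall r, (0 <= g r)%E.
Hypothesis g_ge1 : forall i x y, (i < n)%N -> A i x -> Q i y ->
  (1 <= g (nrm (x - y)))%E.

Local Open Scope ereal_scope.
Implicit Types v : 'rV[R]_d -> R.

(** This is the cost of replacing [v] on [A i] by the constant [v y]. *)
Let F v i y : \bar R := \int[mu]_(x in A i) (`|v x - v y| `^ p)%:E.

Let F_ge0 v i y : 0 <= F v i y.
Proof. by apply: integral_ge0 => x _; rewrite lee_fin powR_ge0. Qed.

Let mF v i : measurable_fun setT v -> measurable_fun setT (F v i).
Proof.
move=> mv.
have := @measurable_integral_radial_pdiff _ _ _ nrm_norm p (cst 1) v (A i) (mA i)
  (fun=> lee01) (measurable_cst _) mv.
apply: eq_measurable_fun => y _; apply: eq_integral => x _.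
by rewrite /radial_pdiff/= mule1.
Qed.

(** The weight is at least 1 for [x] in [A i] and [y] in [Q i]. For fixed [y] the sets [A i] are
    disjoint, so the sum over [i] stays below a single integral over [Omega], even where the sets
    [Q i] overlap. *)
Let sum_F_le v : measurable_fun setT v ->
  \sum_(i < n) \int[mu]_(y in Q i) F v i y <=
  \int[mu]_(y in Omega) \int[mu]_(x in Omega) radial_pdiff nrm p g v x y.
Proof.
move=> mv.
have FQ (i : 'I_n) : \int[mu]_(y in Q i) F v i y =
    \int[mu]_(y in Omega) (F v i \_ (Q i)) y.
  rewrite [LHS]integral_mkcond [RHS]integral_mkcond -patch_setI.
  by rewrite (setIidr (QOmega (ltn_ord i))).
under eq_bigr do rewrite FQ.
rewrite -ge0_integral_sum//; last 2 first.
- move=> i; apply: measurable_funTS.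
  by apply/(measurable_restrictT _ _).1 => //; apply: measurable_funTS; exact: mF.
- by move=> i y _; rewrite erestrict_ge0.
apply: ge0_le_integral_nomeas.
  by move=> y _; rewrite sume_ge0// => i _; rewrite erestrict_ge0.
move=> y Oy.
rewrite (ge0_integral_partition _ mA tA OmegaA); last 2 first.
- exact: measurable_radial_pdiff1.
- by move=> x; exact: radial_pdiff_ge0.
apply: lee_sum => i _; rewrite /patch; case: ifPn => [|_]; last first.
  by apply: integral_ge0 => x _; exact: radial_pdiff_ge0.
rewrite inE => Qy; apply: ge0_le_integral_nomeas.
  by move=> x _; rewrite lee_fin powR_ge0.
move=> x Ax; rewrite /radial_pdiff lee_pemulr ?lee_fin ?powR_ge0//.
exact: (g_ge1 (ltn_ord i)).
Qed.

(** Each [c i] is the value of [v] at a point of [Q i] where [Phi i] exceeds [J i / q], a bound for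
    its average, by less than [del]. That [B] is independent of [v] allows the constants of a
    sequence to have limits. *)
Lemma step_approximation (a m e : R) : (0 <= a)%R -> (0 <= m)%R -> (0 < e)%R ->
  exists B : R, forall v, measurable_fun setT v ->
    \int[mu]_(y in Omega) \int[mu]_(x in Omega) radial_pdiff nrm p g v x y <= a%:E ->
    \int[mu]_(x in Omega) (`|v x| `^ p)%:E <= m%:E ->
  exists c : 'I_n -> R, (forall i, `|c i| <= B)%R /\
    \sum_(i < n) \int[mu]_(x in A i) (`|v x - c i| `^ p)%:E <= (a / q + e)%:E.
Proof.
move=> a0 m0 e0.
(* [lam] and [del] make each of the accumulated errors [n * lam * m / q] and [n * del] at most
   [e / 2]; the added 1 keeps the denominators positive. *)
pose lam : R := (e * q / (2 * (n%:R + 1) * (m + 1)))%R.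
pose del : R := (e / (2 * (n%:R + 1)))%R.
have n1 : (0 < n%:R + 1 :> R)%R by rewrite ltr_wpDl.
have m1 : (0 < m + 1 :> R)%R by rewrite ltr_wpDl.
have lam0 : (0 < lam)%R by rewrite divr_gt0 ?mulr_gt0.
have del0 : (0 < del)%R by rewrite divr_gt0 ?mulr_gt0.
(* [t0] bounds every [Phi i] at its selected point, hence also [lam] times the [p]-th power of the
   selected value. *)
pose t0 : R := ((a + n%:R * lam * m) / q + del)%R.
exists ((t0 / lam) `^ p^-1)%R => v mv va vm.
(* The second term keeps the selected values v (y i) bounded, uniformly in v. *)
pose Phi i y := F v i y + (lam * `|v y| `^ p)%:E.
pose J i := \int[mu]_(y in Q i) Phi i y.
have mvp : measurable_fun setT (fun y => (`|v y| `^ p)%:E).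
  have := measurable_pdiff p 0 mv.
  by apply: eq_measurable_fun => x _; rewrite subr0.
have Phi0 i y : 0 <= Phi i y by rewrite adde_ge0// lee_fin mulr_ge0 ?powR_ge0// ltW.
have J0 i : 0 <= J i by apply: integral_ge0.
have JE i : (i < n)%N -> J i <= \int[mu]_(y in Q i) F v i y + (lam * m)%:E.
  move=> ltin; rewrite /J /Phi ge0_integralD//; last 3 first.
  - by apply: measurable_funTS; exact: mF.
  - by move=> y _; rewrite lee_fin mulr_ge0 ?powR_ge0// ltW.
  - under eq_fun do rewrite EFinM.
    by apply: measurable_funeM; exact: measurable_funTS.
  rewrite leeD2l//; under eq_integral do rewrite EFinM.
  rewrite ge0_integralZl_EFin//; last 2 first.
  - exact: measurable_funTS.
  - exact: ltW.
  rewrite (EFinM lam m) lee_wpmul2l ?lee_fin ?(ltW lam0)//.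
  apply: le_trans vm; apply: ge0_subset_integral => //.
  - exact: measurable_funTS.
  - exact: QOmega.
have sumJ : \sum_(i < n) J i <= (a + n%:R * lam * m)%:E.
  apply: (@le_trans _ _ (\sum_(i < n) (\int[mu]_(y in Q i) F v i y + (lam * m)%:E))).
    by apply: lee_sum => i _; exact: JE.
  rewrite big_split/= EFinD leeD//; first exact: le_trans (sum_F_le mv) va.
  by rewrite sumEFin lee_fin sumr_const card_ord -(mulr_natl (lam * m)) mulrA.
have Jle (i : 'I_n) : J i <= (a + n%:R * lam * m)%:E.
  by apply: le_trans sumJ; rewrite (bigD1 i)//= leeDl// sume_ge0.
have Jfin (i : 'I_n) : J i \is a fin_num.
  by rewrite ge0_fin_numE//; exact: le_lt_trans (Jle i) (ltry _).
have /choice[y hy] (i : 'I_n) : exists y,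
    Q i y /\ Phi i y < (fine (J i) / q + del)%:E.
  have [|||||y Qy hy] := @exists_le_average _ _ _ mu (Q i) (Phi i) q (fine (J i) / q + del)%R.
  - exact: mQ.
  - by [].
  - by rewrite addr_ge0 ?(ltW del0)// divr_ge0 ?fine_ge0// ltW.
  - exact: qQ.
  - rewrite -/(J i) -[in ltLHS](fineK (Jfin i)) lte_fin mulrDl divfK ?gt_eqF//.
    by rewrite ltrDl mulr_gt0.
  by exists y.
have PhiF i z : F v i z <= Phi i z.
  by rewrite leeDl// lee_fin mulr_ge0 ?powR_ge0// ltW.
exists (v \o y); split=> [i|] /=.
  have : (lam * `|v (y i)| `^ p)%:E <= t0%:E.
    apply: (@le_trans _ _ (Phi i (y i))); first by rewrite leeDr.
    apply: (le_trans (ltW (hy i).2)); rewrite lee_fin lerD2r ler_pM2r ?invr_gt0//.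
    by rewrite -lee_fin fineK.
  rewrite lee_fin mulrC -ler_pdivlMr// => vt.
  have vy : (`|v (y i)| = (`|v (y i)| `^ p) `^ p^-1)%R.
    by rewrite -powRrM mulfV ?gt_eqF// powRr1.
  rewrite vy ge0_ler_powR ?nnegrE ?powR_ge0 ?invr_ge0 ?(ltW p_gt0)//.
  by apply: le_trans vt; rewrite powR_ge0.
apply: (@le_trans _ _ (\sum_(i < n) (fine (J i) / q + del)%:E)).
  apply: lee_sum => i _; apply: le_trans (ltW (hy i).2); exact: PhiF.
rewrite sumEFin lee_fin big_split/= sumr_const card_ord -mulr_suml.
have sumfJ : (\sum_(i < n) fine (J i) <= a + n%:R * lam * m)%R.
  by rewrite -lee_fin -sumEFin; under eq_bigr do rewrite fineK//.
set z := ((\sum_(i < n) _) / q)%R.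
have : (z <= (a + n%:R * lam * m) / q)%R.
  by rewrite ler_pM2r ?invr_gt0.
have -> : ((a + n%:R * lam * m) / q =
    a / q + e / 2 * (n%:R / (n%:R + 1)) * (m / (m + 1)))%R.
  by rewrite /lam; field; rewrite !gt_eqF.
have -> : (del *+ n = e / 2 * (n%:R / (n%:R + 1)))%R.
  by rewrite /del -mulr_natl; field; rewrite gt_eqF.
have : (0 <= (n%:R : R) / (n%:R + 1) <= 1)%R.
  apply/andP; split; first by rewrite divr_ge0// ltW.
  by rewrite ler_pdivrMr// mul1r lerDl.
have : (0 <= m / (m + 1) <= 1)%R.
  apply/andP; split; first by rewrite divr_ge0// ltW.
  by rewrite ler_pdivrMr// mul1r lerDl.
set s := (n%:R / _)%R; set r := (m / _)%R => /andP[r0 r1] /andP[s0 s1].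
have : (s * r <= 1)%R by rewrite mulr_ile1.
move=> sr.
have h1 : (e / 2 * s * r <= e / 2)%R.
  by rewrite -mulrA ler_piMr// divr_ge0// ltW.
have h2 : (e / 2 * s <= e / 2)%R.
  by rewrite ler_piMr// divr_ge0// ltW.
move=> h3; lra.
Qed.

(** By compactness of the segment the sequence has a cluster point along [U]. The ultrafilter
    contains this set or its complement, and the complement misses a neighbourhood of the cluster
    point. *)
Lemma ultra_bounded_cvg (U : set_system nat) (UU : UltraFilter U) (c : nat -> R)
    (B th : R) : (forall k, `|c k| <= B)%R -> (0 < th)%R ->
  exists r : R, U [set k | `|c k - r| < th]%R.
Proof.
move=> cB th0.
have PU : ProperFilter U by exact: ultra_proper.
have [|r [_ clr]] := @segment_compact R (- B) B (c @ U) (fmap_proper_filter c PU).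
  apply: (@filterS _ U _ setT); last exact: filterT.
  by move=> k _ /=; rewrite in_itv/= -ler_norml.
exists r; have [//|nU] := in_ultra_setVsetC [set k | `|c k - r| < th]%R UU.
have [|t [/= nt rt]] := clr [set t | ~ (`|t - r| < th)%R] _ _ (nbhsx_ballx r _ th0).
  exact: nU.
by exfalso; apply: nt; move: rt; rewrite -ball_normE /= distrC.
Qed.

(** [v_ k] and [v_ l] are compared through their step functions. The finitely many values converge
    along [U], so on a set of [U] they are within [w / 2] of their limits; the three errors are
    [a / q + e / 4] twice and at most [e / 2]. *)
Lemma step_cauchy (U : set_system nat) (UU : UltraFilter U)
    (v_ : nat -> 'rV[R]_d -> R) (a m e : R) :
  mu Omega < +oo -> (0 <= a)%R -> (0 <= m)%R -> (0 < e)%R ->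
  (forall k, measurable_fun setT (v_ k)) ->
  (forall k, \int[mu]_(x in Omega) (`|v_ k x| `^ p)%:E <= m%:E) ->
  U [set k | \int[mu]_(y in Omega) \int[mu]_(x in Omega)
               radial_pdiff nrm p g (v_ k) x y <= a%:E] ->
  exists2 S, U S & forall k l, S k -> S l ->
    \int[mu]_(x in Omega) (`|v_ k x - v_ l x| `^ p)%:E <=
    (3 `^ p * (2 * (a / q) + e))%:E.
Proof.
move=> Ooo a0 m0 e0 mv vm US0; set S0 := mkset _ in US0.
have e40 : (0 < e / 4)%R by rewrite divr_gt0.
have [B hB] := step_approximation a0 m0 e40.
(* Indices outside [S0] get the value 0, so the constants are bounded along the whole sequence;
   [maxr B 0] covers this default. *)
have /choice[c hc] k : exists c : 'I_n -> R, (forall i, `|c i| <= maxr B 0)%R /\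
    (S0 k -> \sum_(i < n) \int[mu]_(x in A i) (`|v_ k x - c i| `^ p)%:E <=
             (a / q + e / 4)%:E).
  have [S0k|nS0k] := pselect (S0 k).
    have [c [cB hc]] := hB _ (mv k) S0k (vm k); exists c; split=> // i.
    by rewrite le_max cB.
  by exists (fun=> 0%R); split=> // i; rewrite normr0 le_max lexx orbT.
pose M := fine (mu Omega).
have muO : mu Omega = M%:E by rewrite fineK// ge0_fin_numE.
have M0 : (0 <= M)%R by rewrite fine_ge0.
(* [w] is such that [w^p] times the measure of [Omega] is at most [e / 2]. *)
pose w : R := ((e / (2 * (M + 1))) `^ p^-1)%R.
have w0 : (0 < w)%R by rewrite powR_gt0// divr_gt0// mulr_gt0// ltr_wpDl.
have wp : (w `^ p = e / (2 * (M + 1)))%R.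
  rewrite -powRrM mulVf ?gt_eqF// powRr1// ltW// divr_gt0// mulr_gt0//.
  by rewrite ltr_wpDl.
have /choice[r hr] (i : 'I_n) : exists r, U [set k | `|c k i - r| < w / 2]%R.
  apply: (@ultra_bounded_cvg _ UU (fun k => c k i) (maxr B 0)%R); last by rewrite divr_gt0.
  by move=> k; exact: (hc k).1.
pose S := S0 `&` [set k | forall i, (`|c k i - r i| < w / 2)%R].
have US : U S by apply: filterI => //; exact: filter_forall.
have mpd k (t : R) D : measurable_fun D (fun x => (`|v_ k x - t| `^ p)%:E).
  by apply: measurable_funTS; exact: measurable_pdiff.
exists S => // k l [S0k ck] [S0l cl].
rewrite (ge0_integral_partition _ mA tA OmegaA); last 2 first.
- apply/measurable_EFinP.
  suff mB : measurable_fun setT (fun x => `|v_ k x - v_ l x|%R).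
    exact: (measurableT_comp (measurable_powR p) mB).
  by apply: measurableT_comp => //; exact: measurable_funB.
- by move=> x; rewrite lee_fin powR_ge0.
pose f k (i : 'I_n) := \int[mu]_(x in A i) (`|v_ k x - c k i| `^ p)%:E.
apply: (@le_trans _ _ (\sum_(i < n)
    (3 `^ p)%:E * (f k i + \int[mu]_(x in A i) (cst (w `^ p)%:E x) + f l i))).
  apply: lee_sum => i _.
  rewrite /f -ge0_integralD//; [|by move=> x _; rewrite lee_fin powR_ge0].
  rewrite -ge0_integralD//; last 2 first.
  - by move=> x _; rewrite adde_ge0// lee_fin powR_ge0.
  - exact: emeasurable_funD.
  rewrite -ge0_integralZl_EFin//; last 2 first.
  - by move=> x _; rewrite !adde_ge0// lee_fin powR_ge0.
  - by apply: emeasurable_funD => //; exact: emeasurable_funD.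
  apply: ge0_le_integral_nomeas => x _; first by rewrite lee_fin powR_ge0.
  rewrite /= -!EFinD -EFinM lee_fin.
  apply: le_trans (powRD3_le _ _ _ _); rewrite ?(ltW p_gt0)// ?(ltW w0)//.
  rewrite ge0_ler_powR ?(ltW p_gt0)// ?nnegrE ?addr_ge0// ?(ltW w0)//.
  have -> : (v_ k x - v_ l x = (v_ k x - c k i) + (c k i - r i) +
      ((r i - c l i) + (c l i - v_ l x)))%R by ring.
  have := ler_normD (v_ k x - c k i + (c k i - r i))%R
    (r i - c l i + (c l i - v_ l x))%R.
  have := ler_normD (v_ k x - c k i)%R (c k i - r i)%R.
  have := ler_normD (r i - c l i)%R (c l i - v_ l x)%R.
  have := ck i; have := cl i; rewrite (distrC (c l i)) (distrC (v_ l x)).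
  by move=> h1 h2 h3 h4 h5; lra.
rewrite -ge0_sume_distrr; last first.
  move=> i _; apply: adde_ge0; first apply: adde_ge0.
  - by apply: integral_ge0 => x _; rewrite lee_fin powR_ge0.
  - by apply: integral_ge0 => x _; rewrite lee_fin powR_ge0.
  - by apply: integral_ge0 => x _; rewrite lee_fin powR_ge0.
rewrite big_split/= big_split/= EFinM lee_wpmul2l ?lee_fin ?powR_ge0//.
have -> : \sum_(i < n) \int[mu]_(x in A i) (w `^ p)%:E = (w `^ p * M)%:E.
  rewrite -(@ge0_integral_partition _ _ _ mu _ _ _ (cst (w `^ p)%:E) mA tA OmegaA).
  - by rewrite integral_cst// EFinM; congr (_ * _).
  - exact: measurable_cst.
  - by move=> x; rewrite lee_fin powR_ge0.
apply: (@le_trans _ _ ((a / q + e / 4)%:E + (w `^ p * M)%:E + (a / q + e / 4)%:E)).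
  by rewrite leeD// ?leeD2r//; [exact: (hc k).2|exact: (hc l).2].
rewrite -!EFinD lee_fin.
have : (w `^ p * M <= e / 2)%R.
  have -> : (w `^ p * M = e / 2 * (M / (M + 1)))%R.
    by rewrite wp; field; rewrite gt_eqF// ltr_wpDl.
  rewrite ler_piMr// ?divr_ge0// ?(ltW e0)// ler_pdivrMr ?ltr_wpDl//.
  by rewrite mul1r lerDl.
lra.
Qed.

End approximation.

(** * Lebesgue measure of norm balls *)

Section ball_measure.
Context (R : realType) (d : nat).
Local Notation mu := (@lebesgue_rV R d).
Context (nrm : 'rV[R]_d -> R) (nrm_norm : is_norm nrm) (C : R) (C_gt0 : 0 < C).
Hypothesis nrmC : forall x, nrm x <= C * `|x| /\ `|x| <= C * nrm x.
Local Open Scope ereal_scope.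

Lemma measurable_is_norm_ball y s : measurable [set z | nrm (z - y) < s]%R.
Proof. by apply: open_measurable_rV; exact: is_norm_open_ball. Qed.

(** The ball contains the cube of side [s / C] centred at [y]. *)
Lemma lebesgue_rV_ball_ge y s : (0 < s)%R ->
  ((s / C) ^+ d)%:E <= mu [set z | nrm (z - y) < s]%R.
Proof.
move=> s0; pose r : R := (s / C / 2)%R.
have r0 : (0 < r)%R by rewrite !divr_gt0.
apply: (@le_trans _ _ (mu [set z : 'rV[R]_d |
    forall i, ball (y ord0 i : R) r (z ord0 i)])).
  rewrite (@lebesgue_rV_box R d (fun i => ball (y ord0 i) r)); last first.
    by move=> i; exact: measurable_ball.
  under eq_bigr do rewrite lebesgue_measure_ball ?(ltW r0)//.
  rewrite prodEFin prodr_const card_ord.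
  have -> : (r *+ 2 = s / C)%R by rewrite /r mulr2n -splitr.
  exact: lexx.
apply: le_measure; rewrite ?inE.
- by apply: (@measurable_rV_box R d (fun i => ball (y ord0 i) r)) => i; exact: measurable_ball.
- exact: measurable_is_norm_ball.
move=> z /= zr; rewrite (le_lt_trans (nrmC _).1)// mulrC -ltr_pdivlMr//.
apply: (@le_lt_trans _ _ r); last by rewrite ltr_pdivrMr// ltr_pMr ?divr_gt0// ltr1n.
apply/rV_norm_leP => [|i]; first exact: ltW.
by have := zr i; rewrite -ball_normE /= distrC !mxE => /ltW.
Qed.

Lemma lebesgue_rV_ball_le s : (0 < s)%R ->
  mu [set z | nrm z < s]%R <= ((2 * C * s) ^+ d)%:E.
Proof.
move=> s0; pose r : R := (C * s)%R.
have r0 : (0 < r)%R by rewrite mulr_gt0.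
pose B (i : 'I_d) := `[(- r)%R, r]%classic.
apply: (@le_trans _ _ (mu [set z : 'rV[R]_d | forall i, B i (z ord0 i)])).
  apply: le_measure; rewrite ?inE.
  - have := measurable_is_norm_ball 0 s.
    by congr (measurable _); apply/seteqP; split=> z /=; rewrite subr0.
  - by apply: (@measurable_rV_box R d B) => i; exact: measurable_itv.
  move=> z /= zs i; rewrite /B /= in_itv/= -ler_norml.
  rewrite (le_trans (ler_coord_norm z i))// (le_trans (nrmC z).2)//.
  by rewrite ler_pM2l// ltW.
rewrite (@lebesgue_rV_box R d B); last by move=> i; exact: measurable_itv.
rewrite (eq_bigr (fun=> (2 * C * s)%:E)); last first.
  move=> i _; rewrite /B lebesgue_measure_itv/= lte_fin ifT; last by lra.
  by rewrite -EFinD; congr EFin; rewrite /r; ring.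
by rewrite prodEFin prodr_const card_ord lexx.
Qed.

Lemma lebesgue_rV_singleton0 : (0 < d)%N -> mu [set 0%R : 'rV[R]_d] = 0.
Proof.
move=> d0; have -> : [set 0%R : 'rV[R]_d] =
    [set z | forall i, [set 0%R : R] (z ord0 i)].
  by apply/seteqP; split=> z /= => [-> i|z0]; [rewrite mxE|apply/rowP => i; rewrite mxE z0].
rewrite (@lebesgue_rV_box R d (fun=> [set 0%R])); last by move=> i.
by rewrite (bigD1 (Ordinal d0))//= lebesgue_measure_set1 mul0e.
Qed.

End ball_measure.

(** * Dyadic annuli *)

Section annuli.
Context (R : realType) (d : nat).
Local Notation mu := (@lebesgue_rV R d).
Local Open Scope ereal_scope.

(** The interval is half-open so that annuli of successive dyadic radii are disjoint and leave no
    gap. *)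
Definition annulus_ind (rho r : R) : \bar R := (\1_(`[rho / 2, rho[%classic) r)%:E.

Lemma measurable_annulus_ind rho : measurable_fun setT (annulus_ind rho).
Proof. by apply/measurable_EFinP; apply: measurable_indic. Qed.

Lemma annulus_ind_ge0 rho r : 0 <= annulus_ind rho r.
Proof. by rewrite lee_fin. Qed.

Lemma annulus_ind1 rho r : (rho / 2 <= r < rho)%R -> annulus_ind rho r = 1.
Proof. by move=> h; rewrite /annulus_ind indicE mem_set//= in_itv. Qed.

Lemma annulus_ind0 rho r : ~~ (rho / 2 <= r < rho)%R -> annulus_ind rho r = 0.
Proof.
move=> h; rewrite /annulus_ind indicE memNset//= in_itv/=.
by move: h => /negP.
Qed.

Definition dyadic (rho0 : R) (j : nat) : R := (rho0 / 2 ^+ j)%R.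

Lemma dyadicS rho0 j : dyadic rho0 j.+1 = (dyadic rho0 j / 2)%R.
Proof. by rewrite /dyadic exprSr invfM mulrA. Qed.

Lemma dyadic_gt0 rho0 j : (0 < rho0)%R -> (0 < dyadic rho0 j)%R.
Proof. by move=> r0; rewrite divr_gt0// exprn_gt0. Qed.

Lemma dyadic_nonincreasing rho0 i j : (0 < rho0)%R -> (i <= j)%N ->
  (dyadic rho0 j <= dyadic rho0 i)%R.
Proof.
move=> r0 ij; rewrite ler_pM2l// lef_pV2 ?posrE ?exprn_gt0//.
by rewrite ler_weXn2l// ler1n.
Qed.

Lemma dyadic_annulus rho0 r : (0 < r)%R -> (r < rho0)%R ->
  exists j, (dyadic rho0 j.+1 <= r < dyadic rho0 j)%R.
Proof.
move=> r0 rr0.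
have ex : exists n, (dyadic rho0 n <= r)%R.
  exists (Num.bound (rho0 / r)%R).
  rewrite /dyadic ler_pdivrMr ?exprn_gt0// mulrC -ler_pdivrMr//.
  have rr : (0 <= rho0 / r)%R by rewrite divr_ge0// ltW// (lt_trans r0).
  rewrite (le_trans (ltW (archi_boundP rr)))//.
  by rewrite -natrX ler_nat ltnW// ltn_expl.
case: (ex_minnP ex) => -[|j] hj minj.
  by move: hj; rewrite /dyadic expr0 divr1 leNgt rr0.
exists j; rewrite hj /= ltNge; apply/negP => /minj.
by rewrite ltnn.
Qed.

(** At most one annulus contains [r], and there [r] is below the outer radius, at which [kap] is
    therefore no larger. *)
Lemma sum_annulus_ind_le (kap : R -> \bar R) (rho0 r : R) J : (0 < rho0)%R ->
  (forall s, 0 <= kap s) -> (forall s t, (s <= t)%R -> kap t <= kap s) ->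
  \sum_(j < J) kap (dyadic rho0 j) * annulus_ind (dyadic rho0 j) r <= kap r.
Proof.
move=> rho00 kap0 kapd.
have [[j jr]|nj] := pselect (exists j : 'I_J,
    (dyadic rho0 j / 2 <= r < dyadic rho0 j)%R); last first.
  rewrite big1// => j _; rewrite annulus_ind0 ?mule0//; apply/negP => jr.
  by apply: nj; exists j.
rewrite (bigD1 j)//= big1 ?adde0; last first.
  move=> i ij; rewrite annulus_ind0 ?mule0//; apply/negP => /andP[ir1 ir2].
  case/andP: jr => jr1 jr2; move: ij; rewrite -val_eqE neq_ltn /= => /orP[|] ij.
  - have := dyadic_nonincreasing rho00 ij; rewrite dyadicS => h.
    by have := lt_le_trans jr2 h; rewrite ltNge ir1.
  - have := dyadic_nonincreasing rho00 ij; rewrite dyadicS => h.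
    by have := lt_le_trans ir2 h; rewrite ltNge jr1.
by rewrite annulus_ind1// mule1 kapd// ltW//; case/andP: jr.
Qed.

End annuli.

(** * Decomposition of the domain at a given scale *)

Section partition.
Context (R : realType) (d : nat).
Local Notation mu := (@lebesgue_rV R d).
Context (nrm : 'rV[R]_d -> R) (nrm_norm : is_norm nrm) (C : R) (C_gt0 : 0 < C).
Hypothesis nrmC : forall x, nrm x <= C * `|x| /\ `|x| <= C * nrm x.
Context (Omega : set 'rV[R]_d) (oO : open Omega) (bO : bounded_set Omega).
Context (eta : R) (eta_gt0 : 0 < eta) (eta_le : eta <= 8^-1).
Hypothesis ckO : forall x, Omega x -> corkscrew nrm Omega eta x.

(** The balls centred in [Omega] already cover its closure, which is compact. *)
Lemma finite_net s : 0 < s -> exists (n : nat) (x : nat -> 'rV[R]_d),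
  (forall i, (i < n)%N -> Omega (x i)) /\
  forall y, Omega y -> exists2 i, (i < n)%N & nrm (y - x i) < s.
Proof.
move=> s0.
have : compact (closure Omega).
  by apply: bounded_closed_compact; [exact: bounded_closure|exact: closed_closure].
rewrite compact_cover => /(_ _ Omega (fun x => [set y | nrm (y - x) < s])).
case=> [x _|y cly|D DO Dcover].
- exact: is_norm_open_ball.
- have [x [Ox yx]] : Omega `&` [set x | nrm (x - y) < s] !=set0.
    apply: cly; apply: open_nbhs_nbhs; split; first exact: is_norm_open_ball.
    by rewrite /= subrr is_norm0.
  by exists x => //=; rewrite is_normBC.
exists (size (finmap.enum_fset D)), (nth 0 (finmap.enum_fset D)); split=> [i iD|y Oy].
  by have := DO _ (mem_nth 0 iD); rewrite inE.
have [x /= xD yx] := Dcover y (subset_closure Oy).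
exists (index x (finmap.enum_fset D)); first by rewrite index_mem.
by rewrite nth_index.
Qed.

(** The [A i] are the pieces of a net of radius [rho / 16], made disjoint; [Q i] is the corkscrew
    ball of the [i]-th net point for the distance [3 / 4 * rho]. *)
Lemma scale_partition rho : 0 < rho -> 3 / 4 * rho < eta ->
  exists (n : nat) (A Q : nat -> set 'rV[R]_d),
  [/\ forall i, measurable (A i), trivIset setT A,
      Omega = \big[setU/set0]_(i < n) A i, forall i, measurable (Q i) &
   [/\ forall i, (i < n)%N -> Q i `<=` Omega,
      forall i, (i < n)%N ->
        (((3 / 4 * eta * rho / C) ^+ d)%:E <= mu (Q i))%E &
      forall i x y, (i < n)%N -> A i x -> Q i y ->
        (1 <= annulus_ind rho (nrm (x - y)))%E]].
Proof.
move=> rho0 rhoeta.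
have [n [x [xO xnet]]] := @finite_net (rho / 16) ltac:(by rewrite divr_gt0).
pose s := eta * (3 / 4 * rho).
have s0 : 0 < s by rewrite !mulr_gt0.
have /choice[y hy] (i : nat) : exists y, (i < n)%N ->
    nrm (y - x i) = 3 / 4 * rho /\ [set z | nrm (z - y) < s] `<=` Omega.
  case: (ltnP i n) => [ltin|_]; last by exists 0.
  have rho34 : 0 < 3 / 4 * rho by rewrite mulr_gt0.
  by have [y yx yO] := ckO (xO _ ltin) rho34 rhoeta; exists y.
pose F i := Omega `&` [set z | nrm (z - x i) < rho / 16].
exists n, (seqDU F), (fun i => [set z | nrm (z - y i) < s]).
have mF i : measurable (F i).
  by apply: measurableI; [exact: open_measurable_rV|exact: measurable_is_norm_ball].
split.
- by move=> i; apply: measurableD => //; exact: bigsetU_measurable.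
- exact: trivIset_seqDU.
- rewrite -bigsetU_seqDU; apply/seteqP; split=> z.
    move=> Oz; have [i ltin zi] := xnet _ Oz.
    by rewrite -bigcup_mkord; exists i.
  by rewrite -bigcup_mkord => -[i _ []].
- by move=> i; exact: measurable_is_norm_ball.
split.
- by move=> i ltin; exact: (hy i ltin).2.
- move=> i ltin.
  have := lebesgue_rV_ball_ge nrm_norm C_gt0 nrmC (y i) s0.
  by rewrite /s (_ : eta * (3 / 4 * rho) = 3 / 4 * eta * rho)//; ring.
move=> i a b ltin [[_ /= ax] _] /= bz; have [yx _] := hy i ltin.
rewrite annulus_ind1//.
(* A point of [A i] is within [rho / 16] of [x i] and one of [Q i] within [3 / 32 * rho] of [y i],
   so their distance lies between [19 / 32 * rho] and [29 / 32 * rho]. *)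
have sle : s <= 3 / 32 * rho.
  rewrite /s (_ : 3 / 32 * rho = 8^-1 * (3 / 4 * rho)); last by field.
  by rewrite ler_pM2r// mulr_gt0.
have h1 := is_norm_triangle nrm_norm (x i) a b.
have h2 := is_norm_triangle nrm_norm (y i) (x i) b.
have h3 := is_norm_triangle nrm_norm b (y i) (x i).
have h4 := is_norm_triangle nrm_norm a b (x i).
have := is_normBC nrm_norm (y i) b.
have := is_normBC nrm_norm (y i) (x i).
have := is_normBC nrm_norm a b.
move=> e1 e2 e3; apply/andP; split; lra.
Qed.

End partition.

(** * Existence of a scale with small cost *)

Section pigeonhole.
Context (R : realType) (d : nat) (d_gt0 : (0 < d)%N).
Local Notation mu := (@lebesgue_rV R d).
Context (nrm : 'rV[R]_d -> R) (nrm_norm : is_norm nrm) (C : R) (C_gt0 : 0 < C).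
Hypothesis nrmC : forall x, nrm x <= C * `|x| /\ `|x| <= C * nrm x.
Context (kap : R -> \bar R) (rho0 : R) (rho0_gt0 : 0 < rho0).
Hypothesis kap_ge0 : forall r, (0 <= kap r)%E.
Hypothesis mkap : measurable_fun setT kap.
Hypothesis kap_noninc : forall r s, r <= s -> (kap s <= kap r)%E.
Local Open Scope ereal_scope.
Local Notation rho_ := (dyadic rho0).

Let mnrm : measurable_fun setT nrm.
Proof. by apply: continuous_measurable_rV; exact: is_norm_continuous. Qed.

(** On the annulus from [rho_ j.+1] to [rho_ j], [kap] is at most its value at the inner radius, and
    the volume is at most [(2 * C * rho_ j)^d = (4 * C)^d * rho_ j.+1^d]; the sum thus controls the
    integral near the origin. *)
Lemma integral_profile_lty (b : R) :
  \int[mu]_(z in [set z | rho0 <= nrm z]%R) kap (nrm z) < +oo ->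
  (forall J, \sum_(j < J) kap (rho_ j) * (rho_ j ^+ d)%:E <= b%:E) ->
  \int[mu]_z kap (nrm z) < +oo.
Proof.
move=> tail hb.
(* Index 0 is the outer region and [j.+1] the [j]-th annulus; together they miss only the origin, a
   null set. *)
pose F n := match n with
  | 0 => [set z | rho0 <= nrm z]%R
  | j.+1 => [set z | rho_ j.+1 <= nrm z < rho_ j]%R
  end.
have mF n : measurable (F n).
  case: n => [|j].
    have := mnrm measurableT (measurable_itv `[rho0, +oo[).
    by rewrite setTI; congr (measurable _); apply/seteqP; split=> z /=;
      rewrite in_itv/= andbT.
  have := mnrm measurableT (measurable_itv `[rho_ j.+1, rho_ j[).
  by rewrite setTI; congr (measurable _); apply/seteqP; split=> z /=; rewrite in_itv.
have tF : trivIset setT F.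
  apply/trivIsetP => i j _ _; wlog ij : i j / (i < j)%N.
    move=> wh; rewrite neq_ltn => /orP[] ij; first by apply: wh; rewrite ?ltn_eqF.
    by rewrite setIC; apply: wh; rewrite ?ltn_eqF.
  move=> _; apply/seteqP; split=> // z [].
  case: j ij => // j; rewrite ltnS => ij Fi /= /andP[_ zj].
  have zi : (nrm z < rho_ i)%R.
    exact: lt_le_trans zj (dyadic_nonincreasing rho0_gt0 ij).
  case: i ij Fi zi => [|i] ij /=.
    by rewrite /dyadic expr0 divr1 => /le_lt_trans/[apply]; rewrite ltxx.
  by move=> /andP[h _] /(le_lt_trans h); rewrite ltxx.
have Ff : \bigcup_n F n = setT `\` [set 0%R].
  apply/seteqP; split=> z.
    move=> [[|j] _ /= h]; split=> // z0; move: h; rewrite z0 (is_norm0 nrm_norm).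
      by rewrite leNgt rho0_gt0.
    by rewrite leNgt dyadic_gt0.
  move=> [_ /eqP z0]; have nz := is_norm_gt0 nrm_norm z0.
  have [h|h] := leP rho0 (nrm z); first by exists 0%N.
  by have [j hj] := dyadic_annulus nz h; exists j.+1.
have mk : measurable_fun setT (fun z => kap (nrm z)).
  exact: (measurableT_comp mkap mnrm).
rewrite (@ge0_negligible_integral _ _ _ _ setT [set 0%R : 'rV[R]_d])//; last 2 first.
- have := mnrm measurableT (measurable_set1 0%R).
  rewrite setTI; congr (measurable _); apply/seteqP; split=> z /=.
    by have [_ _] := nrm_norm; exact.
  by move=> ->; exact: is_norm0.
- exact: lebesgue_rV_singleton0.
rewrite -Ff ge0_integral_bigcup//; last first.
  exact: measurable_funTS.
set T := \int[mu]_(z in _) _ in tail.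
have T0 : 0 <= T by apply: integral_ge0.
have b0 : 0 <= b%:E by have := hb 0%N; rewrite big_ord0.
pose M : R := ((4 * C) ^+ d)%R.
have M0 : (0 <= M)%R by rewrite exprn_ge0// mulr_ge0// ltW.
apply: (@le_lt_trans _ _ (T + M%:E * b%:E)); last first.
  by rewrite lte_add_pinfty// -EFinM ltry.
apply: lime_le; first by apply: is_cvg_nneseries => n _ _; apply: integral_ge0.
apply: nearW => n; rewrite big_mkord.
(* The extra term lets the outer region be split off even for [n = 0]. *)
apply: (@le_trans _ _ (\sum_(i < n.+1) \int[mu]_(z in F i) kap (nrm z))).
  by rewrite big_ord_recr/= leeDl// integral_ge0.
rewrite big_ord_recl leeD2l//.
apply: (@le_trans _ _ (M%:E * \sum_(j < n) kap (rho_ j.+1) * (rho_ j.+1 ^+ d)%:E)).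
  rewrite ge0_sume_distrr; last first.
    by move=> i _; rewrite mule_ge0// lee_fin exprn_ge0// ltW// dyadic_gt0.
  apply: lee_sum => j _.
  apply: (@le_trans _ _ (\int[mu]_(z in F j.+1) cst (kap (rho_ j.+1)) z)).
    apply: ge0_le_integral_nomeas => // z /= /andP[h _].
    exact: kap_noninc.
  rewrite integral_cst// muleCA lee_wpmul2l//.
  apply: (@le_trans _ _ (mu [set z | nrm z < rho_ j]%R)).
    apply: le_measure; rewrite ?inE//; last by move=> z /= /andP[].
    have := measurable_is_norm_ball nrm_norm 0 (rho_ j).
    by congr (measurable _); apply/seteqP; split=> z /=; rewrite subr0.
  apply: le_trans (lebesgue_rV_ball_le nrm_norm C_gt0 nrmC (dyadic_gt0 j rho0_gt0)) _.
  rewrite -EFinM lee_fin /M -exprMn dyadicS.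
  by rewrite (_ : 2 * C * rho_ j = 4 * C * (rho_ j / 2))%R//; field.
rewrite lee_wpmul2l//.
apply: le_trans (hb n.+1); rewrite big_ord_recl leeDr//.
by rewrite mule_ge0// lee_fin exprn_ge0// ltW// dyadic_gt0.
Qed.

Context (p : R) (Omega : set 'rV[R]_d) (mOmega : measurable Omega).

Local Notation dint g v :=
  (\int[mu]_(y in Omega) \int[mu]_(x in Omega) radial_pdiff nrm p g v x y).


Lemma double_integral_scale (c : \bar R) (g : R -> \bar R) v : 0 <= c ->
  (forall r, 0 <= g r) -> measurable_fun setT g -> measurable_fun setT v ->
  dint (fun r => c * g r) v = c * dint g v.
Proof.
move=> c0 g0 mg mv; rewrite -ge0_integralZl//; last 2 first.
- by apply: measurable_funTS; exact: measurable_integral_radial_pdiff.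
- by move=> y _; apply: integral_ge0 => x _; exact: radial_pdiff_ge0.
apply: eq_integral => y _; rewrite -ge0_integralZl//; last 2 first.
- by apply: measurable_funTS; exact: measurable_radial_pdiff1.
- by move=> x _; exact: radial_pdiff_ge0.
by apply: eq_integral => x _; rewrite /radial_pdiff muleCA.
Qed.

Lemma double_integral_sum J (g : nat -> R -> \bar R) v :
  (forall j r, 0 <= g j r) -> (forall j, measurable_fun setT (g j)) ->
  measurable_fun setT v ->
  \sum_(j < J) dint (g j) v = dint (fun r => \sum_(j < J) g j r) v.
Proof.
move=> g0 mg mv; rewrite -ge0_integral_sum//; last 2 first.
- by move=> j; apply: measurable_funTS; exact: measurable_integral_radial_pdiff.
- by move=> j y _; apply: integral_ge0 => x _; exact: radial_pdiff_ge0.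
apply: eq_integral => y _; rewrite -ge0_integral_sum//; last 2 first.
- by move=> j; apply: measurable_funTS; exact: measurable_radial_pdiff1.
- by move=> j x _; exact: radial_pdiff_ge0.
apply: eq_integral => x _; rewrite /radial_pdiff ge0_sume_distrr//.
Qed.

(** By linearity in the weight this is [sum_annulus_ind_le] under the double integral. *)
Lemma annuli_integral_le (v : 'rV[R]_d -> R) J : measurable_fun setT v ->
  \sum_(j < J) kap (rho_ j) * dint (annulus_ind (rho_ j)) v <= dint kap v.
Proof.
move=> mv; pose g j r := kap (rho_ j) * annulus_ind (rho_ j) r.
have mann j := @measurable_annulus_ind R (rho_ j).
have ann0 j r := @annulus_ind_ge0 R (rho_ j) r.
have g0 j r : 0 <= g j r by rewrite mule_ge0.
under eq_bigr do rewrite -double_integral_scale//.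
rewrite (@double_integral_sum J g)//; last first.
  by move=> j; exact: measurable_funeM.
apply: ge0_le_integral_nomeas => y _.
  by apply: integral_ge0 => x _; apply: radial_pdiff_ge0 => r; rewrite sume_ge0.
apply: ge0_le_integral_nomeas => x _.
  by apply: radial_pdiff_ge0 => r; rewrite sume_ge0.
rewrite lee_wpmul2l ?lee_fin ?powR_ge0//.
exact: sum_annulus_ind_le.
Qed.

(* Otherwise every scale would be bad for some function, and the divergence of
   \sum_j kap (rho_j) rho_j^d would contradict the seminorm bound. *)
Lemma ultra_small_scale (U : set_system nat) (UU : UltraFilter U)
    (v_ : nat -> 'rV[R]_d -> R) (b e : R) :
  \int[mu]_(z in [set z | rho0 <= nrm z]%R) kap (nrm z) < +oo ->
  ~ (\int[mu]_z kap (nrm z) < +oo) -> (0 < e)%R ->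
  (forall k, measurable_fun setT (v_ k)) ->
  (forall k, dint kap (v_ k) <= b%:E) ->
  exists j, U [set k | dint (annulus_ind (rho_ j)) (v_ k) <= (e * rho_ j ^+ d)%:E].
Proof.
move=> tail notL1 e0 mv vb; apply: contrapT => /forallNP noj; apply: notL1.
have bad j : U [set k | (e * rho_ j ^+ d)%:E <= dint (annulus_ind (rho_ j)) (v_ k)].
  have [/noj//|] := in_ultra_setVsetC
    [set k | dint (annulus_ind (rho_ j)) (v_ k) <= (e * rho_ j ^+ d)%:E] UU.
  by apply: filterS => k /negP; rewrite -ltNge => /ltW.
apply: (@integral_profile_lty (b / e)) => // J.
have PU : ProperFilter U by exact: ultra_proper.
(* Finitely many members of [U] meet, so one function is bad at all of the first [J] scales, and its
   seminorm bounds the partial sum by [b / e], whatever [J] is. *)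
have /filter_ex[k /= hk] : U [set k | forall j : 'I_J,
    (e * rho_ j ^+ d)%:E <= dint (annulus_ind (rho_ j)) (v_ k)].
  by apply: filter_forall => j; exact: bad.
rewrite (_ : (b / e)%:E = e^-1%:E * b%:E); last by rewrite -EFinM mulrC.
rewrite lee_pdivlMl//.
rewrite ge0_sume_distrr; last first.
  by move=> j _; rewrite mule_ge0// lee_fin exprn_ge0// ltW// dyadic_gt0.
apply: le_trans (vb k); apply: le_trans (annuli_integral_le J (mv k)).
by apply: lee_sum => j _; rewrite muleCA lee_wpmul2l// -EFinM.
Qed.

End pigeonhole.

(** * Extraction of a subsequence along an ultrafilter *)

Section ultrafilter_subsequence.
Context (R : realType).

(** [phi m] is chosen in [S 0], ..., [S m] and beyond the previous index; this is possible since [U]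
    contains these sets and all tails of the integers. *)
Lemma ultra_cauchy_subsequence (U : set_system nat) (UU : UltraFilter U)
    (D : nat -> nat -> \bar R) (e_ : nat -> R) : \oo `<=` U ->
  (forall e : R, 0 < e -> exists2 S, U S & forall k l, S k -> S l -> (D k l <= e%:E)%E) ->
  (forall n, 0 < e_ n) ->
  exists phi : nat -> nat, {homo phi : m n / (m < n)%N} /\
    forall m i j, (m <= i)%N -> (m <= j)%N -> (D (phi i) (phi j) <= (e_ m)%:E)%E.
Proof.
move=> ooU cD e0; have PU : ProperFilter U by exact: ultra_proper.
have /choice[S hS] m : exists S, U S /\
    forall k l, S k -> S l -> (D k l <= (e_ m)%:E)%E.
  by have [S US hS] := cD _ (e0 m); exists S.
have UT m : U [set k | forall i : 'I_m.+1, S i k].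
  by apply: filter_forall => i; have [] := hS i.
have /choice[f hf] (mN : nat * nat) : exists k,
    (forall i, (i <= mN.1)%N -> S i k) /\ (mN.2 < k)%N.
  have UN : U [set k | (mN.2 < k)%N] by apply: ooU; exists mN.2.+1.
  have /filter_ex[k [Sk Nk]] : U ([set k | forall i : 'I_mN.1.+1, S i k] `&`
    [set k | (mN.2 < k)%N]) by exact: filterI.
  exists k; split=> // i im.
  by have := Sk (Ordinal (im : (i < mN.1.+1)%N)).
pose phi := fix phi m := match m with 0 => f (0, 0)%N | m'.+1 => f (m'.+1, phi m') end.
have Sphi m i : (i <= m)%N -> S i (phi m).
  by case: m => [|m] im; [have [] := hf (0, 0)%N|have [] := hf (m.+1, phi m)];
    move=> h _; exact: h.
exists phi; split.
  by apply: homo_ltn => [? ? ?|m]; [exact: ltn_trans|exact: (hf (m.+1, phi m)).2].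
by move=> m i j mi mj; apply: (hS m).2; exact: Sphi.
Qed.

End ultrafilter_subsequence.

(** * Lower limits and semicontinuity *)

Section lower_limits.
Context (R : realType).
Local Open Scope ereal_scope.

Lemma limn_einf_ge (w : nat -> \bar R) c :
  (\forall n \near \oo, c <= w n) -> c <= limn_einf w.
Proof.
move=> [N _ hN]; rewrite limn_einf_lim; apply: lime_ge; first exact: is_cvg_einfs.
exists N => // n /= Nn; apply: le_ereal_inf_tmp => _ [m /= nm <-].
by apply: hN => /=; exact: leq_trans nm.
Qed.

Lemma limn_einf_le (w : nat -> \bar R) c : (forall n, w n <= c) -> limn_einf w <= c.
Proof.
move=> wc; rewrite limn_einf_lim; apply: lime_le; first exact: is_cvg_einfs.
apply: nearW => n; apply: le_trans (wc n); apply: ereal_inf_lbound.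
by exists n => /=.
Qed.

Lemma le_limn_einf (w : nat -> \bar R) x : (forall n, 0 <= w n) -> 0 <= x ->
  (forall c : R, (0 < c)%R -> c%:E < x -> \forall n \near \oo, c%:E <= w n) ->
  x <= limn_einf w.
Proof.
move=> w0 x0 hx; rewrite leNgt; apply/negP => Lx.
have L0 : 0 <= limn_einf w by apply: limn_einf_ge; exact: nearW.
suff [c [c0 Lc cx]] : exists c : R, [/\ (0 < c)%R, limn_einf w < c%:E & c%:E < x].
  by have := limn_einf_ge (hx _ c0 cx); rewrite leNgt Lc.
move: L0 Lx; case: (limn_einf w) => [l| |].
- rewrite lee_fin => l0.
  case: x x0 {hx} => [r| |] // _; rewrite ?lte_fin => lr.
    by exists ((l + r) / 2)%R; rewrite !lte_fin; split; lra.
  by exists (l + 1)%R; rewrite lte_fin ltry; split=> //; lra.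
- by move=> _; rewrite ltNge leey.
- by rewrite leNgt ltNy0.
Qed.

(** Only semicontinuity holds in general: for [k = +oo] and [t = 0] the left side is 0, while the
    terms with nonzero [t_ n] are infinite. *)
Lemma powR_mule_lsc (p : R) (t : R) (t_ : nat -> R) (k : \bar R) : (0 < p)%R ->
  0 <= k -> t_ n @[n --> \oo] --> t ->
  (`|t| `^ p)%:E * k <= limn_einf (fun n => (`|t_ n| `^ p)%:E * k).
Proof.
move=> p0 k0 ct.
apply: le_limn_einf => [n||c c0 ctk]; rewrite ?mule_ge0 ?lee_fin ?powR_ge0//.
(* Eventually [|t_ n|] exceeds such a [b]. It is [(c / k)^(1/p)] for finite positive [k] and
   [|t| / 2] for infinite [k]. *)
suff [b [b0 bt cb]] : exists b : R, [/\ (0 <= b)%R, (b < `|t|)%R & c%:E <= (b `^ p)%:E * k].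
  have ct' : `|t_ n|%R @[n --> \oo] --> `|t|%R by exact: cvg_norm.
  have : \forall n \near \oo, (b < `|t_ n|)%R.
    exact: (cvgr_gt `|t|%R).
  apply: filterS => n bn; apply: (le_trans cb).
  rewrite lee_wpmul2r// lee_fin ge0_ler_powR ?nnegrE ?(ltW p0)//.
  exact: ltW.
have t0 : (0 < `|t|)%R.
  rewrite normr_gt0; apply/eqP => t0; move: ctk.
  by rewrite t0 normr0 powR0 ?gt_eqF// mul0e lte_fin ltNge (ltW c0).
case: k k0 ctk => [k| |]//; rewrite ?lee_fin.
  rewrite le_eqVlt => /orP[/eqP <-|k0].
    by rewrite mule0 lte_fin ltNge (ltW c0).
  rewrite -EFinM lte_fin -ltr_pdivrMr// => ck.
  have ck0 : (0 < c / k)%R by rewrite divr_gt0.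
  exists ((c / k) `^ p^-1)%R; split; first exact: powR_ge0.
    have -> : (`|t| = (`|t| `^ p) `^ p^-1)%R.
      by rewrite -powRrM mulfV ?gt_eqF// powRr1.
    by rewrite gt0_ltr_powR ?invr_gt0 ?nnegrE ?powR_ge0// ltW.
  rewrite -powRrM mulVf ?gt_eqF// powRr1 ?(ltW ck0)//.
  by rewrite -EFinM divfK// gt_eqF.
move=> _ _; exists (`|t| / 2)%R; split; first by rewrite divr_ge0.
  by rewrite ltr_pdivrMr// ltr_pMr// ltr1n.
by rewrite gt0_muley ?leey// lte_fin powR_gt0// divr_gt0.
Qed.

End lower_limits.

(** * Almost everywhere limit of a fast Cauchy sequence *)

Section ae_limit.
Context d (T : measurableType d) (R : realType) (mu : {measure set T -> \bar R}).
Context (Omega : set T) (mOmega : measurable Omega) (p : R) (p_gt0 : 0 < p).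
Context (v_ : nat -> T -> R) (mv : forall n, measurable_fun setT (v_ n)).
Local Open Scope ereal_scope.

Lemma cvg_of_geometric_increments (x : nat -> R) (M : R) :
  (forall m, `|x m.+1 - x m| <= M * 2^-1 ^+ m)%R -> cvgn x.
Proof.
move=> hx.
have -> : x = (fun n => x 0%N + series (telescope x) n)%R.
  by apply/funext => n; exact: eq_sum_telescope.
apply: is_cvgD; first exact: is_cvg_cst.
apply: normed_cvg; apply: (@series_le_cvg _ _ (geometric M 2^-1%R)).
- by move=> n; exact: normr_ge0.
- by move=> n; apply: le_trans (hx n).
- by move=> n; exact: hx.
apply: is_cvg_geometric_series.
by rewrite ger0_norm ?invr_ge0// invf_lt1// ltr1n.
Qed.

Lemma sum_half_le n : (\sum_(m < n) (2^-1 : R) ^+ m <= 2)%R.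
Proof.
suff -> : (\sum_(m < n) (2^-1 : R) ^+ m = 2 - 2 * 2^-1 ^+ n)%R.
  by rewrite gerBl mulr_ge0// exprn_ge0// invr_ge0.
elim: n => [|n ih]; first by rewrite big_ord0 expr0 mulr1 subrr.
by rewrite big_ord_recr/= ih exprS; field.
Qed.

(** The [p]-th powers [f m] of the increments divided by [2^-m] have integrals at most [2^-m]. Their
    sum [F] is thus finite almost everywhere, and there the increments are at most
    [F^(1/p) * 2^-m]. *)
Lemma fast_cauchy_ae_limit :
  (forall m, \int[mu]_(x in Omega) (`|v_ m.+1 x - v_ m x| `^ p)%:E <=
             ((2^-1 ^+ m) `^ p * 2^-1 ^+ m)%:E) ->
  exists u : T -> R, measurable_fun setT u /\
    {ae mu, forall x, Omega x -> v_ n x @[n --> \oo] --> u x}.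
Proof.
move=> hv.
pose f m x := ((`|v_ m.+1 x - v_ m x| / 2^-1 ^+ m) `^ p)%:E.
have h0 m : (0 < (2^-1 : R) ^+ m)%R by rewrite exprn_gt0// invr_gt0.
have f0 m x : 0 <= f m x by rewrite lee_fin powR_ge0.
have mpd m : measurable_fun setT (fun x => (`|v_ m.+1 x - v_ m x| `^ p)%:E).
  apply/measurable_EFinP.
  suff mB : measurable_fun setT (fun x => `|v_ m.+1 x - v_ m x|%R).
    exact: (measurableT_comp (measurable_powR p) mB).
  by apply: measurableT_comp => //; exact: measurable_funB.
have fE m x : f m x = (((2^-1 ^+ m)^-1 `^ p))%:E * (`|v_ m.+1 x - v_ m x| `^ p)%:E.
  by rewrite -EFinM /f mulrC powRM// invr_ge0 ltW.
have mf m : measurable_fun setT (f m).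
  by rewrite (funext (fE m)); exact: measurable_funeM.
have intf m : \int[mu]_(x in Omega) f m x <= (2^-1 ^+ m)%:E.
  under eq_integral do rewrite fE.
  rewrite ge0_integralZl_EFin ?powR_ge0//; last exact: measurable_funTS.
  apply: (le_trans (lee_wpmul2l _ (hv m))); first by rewrite lee_fin powR_ge0.
  rewrite -EFinM lee_fin mulrA -powRM ?invr_ge0 ?(ltW (h0 _))//.
  by rewrite mulVf ?gt_eqF// powR1 mul1r.
pose F x := \sum_(m <oo) f m x.
have mF : measurable_fun Omega F.
  apply: ge0_emeasurable_sum => //; move=> m _; exact: measurable_funTS.
have F0 x : 0 <= F x by apply: nneseries_ge0.
have intF : mu.-integrable Omega F.
  apply/integrableP; split=> //.
  under eq_integral do rewrite gee0_abs//.
  rewrite integral_nneseries//; last by move=> m; exact: measurable_funTS.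
  apply: (@le_lt_trans _ _ 2%:E); last exact: ltry.
  apply: lime_le.
    by apply: is_cvg_nneseries => n _ _; apply: integral_ge0.
  apply: nearW => n; rewrite big_mkord.
  apply: (@le_trans _ _ (\sum_(m < n) (2^-1 ^+ m)%:E)); first exact: lee_sum.
  by rewrite sumEFin lee_fin sum_half_le.
(* The upper limit is measurable on the whole space and agrees with the limit where that exists. *)
exists (fun x => fine (limn_esup (fun n => (v_ n x)%:E))); split.
  apply: (measurableT_comp (fine_measurable measurableT)).
  by apply: measurable_fun_limn_esup => n; exact/measurable_EFinP.
have := integrable_ae mOmega intF; apply: filterS => x + Ox => /(_ Ox) Ffin.
have /cvg_ex[l xl] : cvgn (v_ ^~ x).
  apply: (@cvg_of_geometric_increments _ ((fine (F x)) `^ p^-1)%R) => m.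
  rewrite -ler_pdivrMr//; set a := (_ / _)%R.
  have a0 : (0 <= a)%R by rewrite divr_ge0// ltW.
  have -> : a = ((a `^ p) `^ p^-1)%R.
    by rewrite -powRrM mulfV ?gt_eqF// powRr1.
  rewrite ge0_ler_powR ?nnegrE ?powR_ge0 ?invr_ge0 ?(ltW p_gt0)// ?fine_ge0//.
  rewrite -lee_fin fineK//; apply: le_trans (nneseries_lim_ge m.+1 _) => //.
  by rewrite big_nat_recr//= leeDr// sume_ge0.
suff -> : limn_esup (fun n => (v_ n x)%:E) = l%:E by [].
have cE : (v_ n x)%:E @[n --> \oo] --> l%:E by apply/cvg_EFin => //; exact: nearW.
by rewrite is_cvg_limn_esupE; [exact/cvg_lim|apply/cvg_ex; exists l%:E].
Qed.

End ae_limit.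

(** * Compactness for a radial nonincreasing kernel *)

Section radial_compactness.
Context (R : realType) (d : nat) (d_gt0 : (0 < d)%N).
Local Notation mu := (@lebesgue_rV R d).
Context (nrm : 'rV[R]_d -> R) (nrm_norm : is_norm nrm).
Context (Omega : set 'rV[R]_d) (oO : open Omega) (bO : bounded_set Omega).
Context (lO : lipschitz_boundary Omega).
Context (kap : R -> \bar R).
Hypothesis kap_ge0 : forall r, (0 <= kap r)%E.
Hypothesis mkap : measurable_fun setT kap.
Hypothesis kap_noninc : forall r s, r <= s -> (kap s <= kap r)%E.
Local Open Scope ereal_scope.
Hypothesis kap_tail : forall r, (0 < r)%R ->
  \int[mu]_(z in [set z | r <= nrm z]%R) kap (nrm z) < +oo.
Hypothesis kap_notL1 : ~ (\int[mu]_z kap (nrm z) < +oo).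
Context (p : R) (p_gt0 : (0 < p)%R).

Local Notation dint g v :=
  (\int[mu]_(y in Omega) \int[mu]_(x in Omega) radial_pdiff nrm p g v x y).

Let mO : measurable Omega. Proof. exact: open_measurable_rV. Qed.

Lemma lebesgue_rV_bounded_lty : mu Omega < +oo.
Proof.
have [C C0 nrmC] := is_norm_equiv nrm_norm.
have [M [_ hM]] := bO.
pose s : R := (C * (Num.max M 0 + 1) + 1)%R.
have M0 : (0 <= Num.max M 0)%R by rewrite le_max lexx orbT.
have s0 : (0 < s)%R by rewrite ltr_wpDl// mulr_ge0 ?addr_ge0// ltW.
apply: (le_lt_trans _ (ltry ((2 * C * s) ^+ d)%R)).
apply: le_trans (lebesgue_rV_ball_le nrm_norm C0 nrmC s0).
have mB : measurable [set z | nrm z < s]%R.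
  have := measurable_is_norm_ball nrm_norm 0 s.
  by congr (measurable _); apply/seteqP; split=> z /=; rewrite subr0.
apply: le_measure; rewrite ?inE// => z Oz /=.
rewrite (le_lt_trans (nrmC _).1)// /s ltr_pwDr// ler_pM2l//.
apply: hM => //; rewrite ltr_pwDr//.
by rewrite le_max lexx.
Qed.

Section sequence.
Context (v_ : nat -> 'rV[R]_d -> R) (m b : R).
Hypothesis m_ge0 : (0 <= m)%R.
Hypothesis mv : forall k, measurable_fun setT (v_ k).
Hypothesis v_Lp : forall k, \int[mu]_(x in Omega) (`|v_ k x| `^ p)%:E <= m%:E.
Hypothesis v_semi : forall k, dint kap (v_ k) <= b%:E.

(** The cost [e1 * rho^d] at the good scale is divided by the volume bound [c * rho^d] of the balls
    [Q i]; the quotient [e1 / c] does not depend on the scale. *)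
Lemma ultra_Lp_cauchy (U : set_system nat) (UU : UltraFilter U) (e : R) :
  (0 < e)%R -> exists2 S, U S & forall k l, S k -> S l ->
    \int[mu]_(x in Omega) (`|v_ k x - v_ l x| `^ p)%:E <= e%:E.
Proof.
move=> e0.
have [C C0 nrmC] := is_norm_equiv nrm_norm.
have [eta0 eta00 ck0] := uniform_corkscrew nrm_norm d_gt0 oO bO lO.
pose eta : R := Num.min eta0 8^-1%R.
have etap : (0 < eta)%R by rewrite lt_min eta00 invr_gt0 ltr0n.
have eta8 : (eta <= 8^-1)%R by rewrite ge_min lexx orbT.
have ck x : Omega x -> corkscrew nrm Omega eta x.
  by move=> Ox; apply: corkscrew_le (ck0 _ Ox); rewrite ge_min lexx.
pose c : R := ((3 / 4 * eta / C) ^+ d)%R.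
have c0 : (0 < c)%R by rewrite exprn_gt0// divr_gt0// mulr_gt0// divr_gt0.
pose th : R := (3 `^ p)%R; have th0 : (0 < th)%R by rewrite powR_gt0.
(* Then [2 * e1 / c] is [e / (2 * th)], and adding [e20]'s [e / (2 * th)] and multiplying by [th]
   gives exactly [e]. *)
pose e1 : R := (c * (e / (4 * th)))%R.
have e10 : (0 < e1)%R by rewrite mulr_gt0// divr_gt0// mulr_gt0.
(* The dyadic scales start at [eta], so each of them satisfies [3 / 4 * rho < eta]. *)
have [j Uj] := ultra_small_scale d_gt0 nrm_norm C0 nrmC etap kap_ge0 mkap kap_noninc
  mO UU (kap_tail etap) kap_notL1 e10 mv v_semi.
set rho := dyadic eta j in Uj.
have rho0 : (0 < rho)%R by exact: dyadic_gt0.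
have rhoeta : (3 / 4 * rho < eta)%R.
  have : (rho <= eta)%R.
    by have := dyadic_nonincreasing etap (leq0n j); rewrite {2}/dyadic expr0 divr1.
  by move=> ?; lra.
have [n [A [Q [mA tA OA mQ [QO qQ gQ]]]]] :=
  scale_partition nrm_norm C0 nrmC oO bO etap eta8 ck rho0 rhoeta.
have q0 : (0 < (3 / 4 * eta * rho / C) ^+ d)%R.
  by rewrite exprn_gt0// divr_gt0// !mulr_gt0// divr_gt0.
have e20 : (0 < e / (2 * th))%R by rewrite divr_gt0// mulr_gt0.
have a0 : (0 <= e1 * rho ^+ d)%R by rewrite mulr_ge0 ?exprn_ge0// ltW.
have [S US hS] := step_cauchy nrm_norm p_gt0 mO mA tA OA mQ QO q0 qQ
  (measurable_annulus_ind rho) (annulus_ind_ge0 rho) gQ UU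
  lebesgue_rV_bounded_lty a0 m_ge0 e20 mv v_Lp Uj.
exists S => // k l Sk Sl; apply: (le_trans (hS _ _ Sk Sl)).
rewrite lee_fin -/th.
have -> : ((3 / 4 * eta * rho / C) ^+ d = c * rho ^+ d)%R.
  by rewrite -exprMn; congr (_ ^+ _)%R; field; rewrite gt_eqF.
rewrite le_eqVlt; apply/orP; left; apply/eqP; rewrite /e1; field.
by rewrite !gt_eqF// exprn_gt0.
Qed.

Lemma radial_compactness : exists (phi : nat -> nat) (u : 'rV[R]_d -> R),
  [/\ {homo phi : i j / (i < j)%N}, measurable_fun setT u,
      \int[mu]_(x in Omega) (`|u x| `^ p)%:E <= m%:E,
      dint kap u <= b%:E &
      forall j, \int[mu]_(x in Omega) (`|v_ (phi j) x - u x| `^ p)%:E <=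
                ((2^-1 ^+ j) `^ p)%:E].
Proof.
(* [U] refines the filter of tails, so its members contain arbitrarily large indices. *)
have [U [UU ooU]] := ultraFilterLemma eventually_filter.
pose e_ j : R := ((2^-1 ^+ j) `^ p * 2^-1 ^+ j)%R.
have half0 j : (0 < (2^-1 : R) ^+ j)%R by rewrite exprn_gt0// invr_gt0.
have e_0 j : (0 < e_ j)%R by rewrite mulr_gt0// powR_gt0.
have [phi [phi_incr hphi]] := ultra_cauchy_subsequence UU
  (D := fun k l => \int[mu]_(x in Omega) (`|v_ k x - v_ l x| `^ p)%:E)
  ooU (ultra_Lp_cauchy UU) e_0.
pose w n := v_ (phi n).
have mw n : measurable_fun setT (w n) by exact: mv.
have [u [mu_ wu]] := @fast_cauchy_ae_limit _ _ _ mu Omega mO p p_gt0 w mw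
  (fun j => hphi j j.+1 j (leqnSn j) (leqnn j)).
have mabs (f : 'rV[R]_d -> R) D : measurable_fun setT f ->
    measurable_fun D (fun x => (`|f x| `^ p)%:E).
  move=> mf; apply: measurable_funTS; apply/measurable_EFinP.
  suff mB : measurable_fun setT (fun x => `|f x|%R).
    exact: (measurableT_comp (measurable_powR p) mB).
  exact: measurableT_comp.
have pow0 (r : R) : 0 <= (r `^ p)%:E by rewrite lee_fin powR_ge0.
have fatou_Lp (f_ : nat -> 'rV[R]_d -> R) (f : 'rV[R]_d -> R) (c : \bar R) :
    (forall n, measurable_fun setT (f_ n)) ->
    {ae mu, forall x, Omega x -> f_ n x @[n --> \oo] --> f x} ->
    (forall n, \int[mu]_(x in Omega) (`|f_ n x| `^ p)%:E <= c) ->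
    \int[mu]_(x in Omega) (`|f x| `^ p)%:E <= c.
  move=> mf ff fc.
  apply: (@le_trans _ _ (\int[mu]_(x in Omega)
      limn_einf (fun n => (`|f_ n x| `^ p)%:E))).
    apply: ge0_ae_le_integral => //.
      by move=> x _; apply: limn_einf_ge; exact: nearW.
    apply: filterS ff => x + Ox => /(_ Ox) fx.
    have := powR_mule_lsc p_gt0 (@lee01 R) fx.
    by rewrite mule1; under [X in limn_einf X]eq_fun do rewrite mule1.
  apply: le_trans (fatou mu mO _ _) _ => //.
    by move=> n; exact: mabs.
  exact: limn_einf_le.
exists phi, u; split=> //.
- by apply: (fatou_Lp w) => // n; exact: v_Lp.
(* Fatou's lemma is applied first in [x] for almost every fixed [y], then in [y]. *)
- apply: (@le_trans _ _ (\int[mu]_(y in Omega)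
      limn_einf (fun n => \int[mu]_(x in Omega) radial_pdiff nrm p kap (w n) x y))).
    apply: ge0_ae_le_integral.
    + by move=> y _; apply: integral_ge0 => x _; exact: radial_pdiff_ge0.
    + move=> y _; apply: limn_einf_ge; apply: nearW => n.
      by apply: integral_ge0 => x _; exact: radial_pdiff_ge0.
    apply: filterS (wu) => y + Oy => /(_ Oy) wy.
    apply: (@le_trans _ _ (\int[mu]_(x in Omega)
        limn_einf (fun n => radial_pdiff nrm p kap (w n) x y))).
      apply: ge0_ae_le_integral.
      + by move=> x _; exact: radial_pdiff_ge0.
      + move=> x _; apply: limn_einf_ge; apply: nearW => n.
        exact: radial_pdiff_ge0.
      apply: filterS (wu) => x + Ox => /(_ Ox) wx.
      by apply: powR_mule_lsc => //; exact: cvgB.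
    apply: fatou => // [n|n x _]; last exact: radial_pdiff_ge0.
    by apply: measurable_funTS; exact: measurable_radial_pdiff1.
  apply: le_trans (fatou mu mO _ _) _ => //.
  + by move=> n; apply: measurable_funTS; exact: measurable_integral_radial_pdiff.
  + by move=> n y _; apply: integral_ge0 => x _; exact: radial_pdiff_ge0.
  + by apply: limn_einf_le => n; exact: v_semi.
- move=> j; apply: (@le_trans _ _ (e_ j)%:E); last first.
    rewrite lee_fin ler_piMr ?powR_ge0// exprn_ile1 ?invr_ge0//.
    by rewrite invf_le1// ler1n.
  (* The shift by [j] puts both indices at or beyond [j], where the Cauchy bound [e_ j] holds; the
     limit in [n] is [w j - u]. *)
  apply: (fatou_Lp (fun n x => w j x - w (n + j)%N x)%R).
  + by move=> n; exact: measurable_funB.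
  + apply: filterS wu => x + Ox => /(_ Ox) wx.
    apply: cvgB; first exact: cvg_cst.
    by have := wx; rewrite -(cvg_shiftn j).
  + by move=> n; apply: hphi => //; exact: leq_addl.
Qed.

End sequence.
End radial_compactness.

(** * Norms as powers of integrals *)

Section norms_and_integrals.
Context (R : realType) (d : nat).
Local Notation mu := (@lebesgue_rV R d).
Context (p : R) (p_gt0 : 0 < p).
Local Open Scope ereal_scope.

Lemma Lp_normE (Omega : set 'rV[R]_d) u :
  Lp_norm p Omega u = (\int[mu]_(x in Omega) (`|u x| `^ p)%:E) `^ p^-1.
Proof.
rewrite /Lp_norm unlock; congr (_ `^ _); rewrite [RHS]integral_mkcond.
apply: eq_integral => x _; rewrite /patch; case: ifPn => // _.
by rewrite abse0 poweR0r// gt_eqF.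
Qed.

Lemma poweRVK (x : \bar R) : 0 <= x -> (x `^ p^-1) `^ p = x.
Proof. by move=> x0; rewrite -poweRrM mulVf ?gt_eqF// poweRe1. Qed.

Lemma poweRV_le (x : \bar R) (M : R) : 0 <= x -> x `^ p^-1 <= M%:E ->
  x <= (M `^ p)%:E.
Proof.
move=> x0 xM; rewrite -[leLHS]poweRVK// -poweR_EFin gt0_ler_poweR ?(ltW p_gt0)//.
- by rewrite in_itv/= poweR_ge0 leey.
- by rewrite in_itv/= (le_trans _ xM) ?poweR_ge0// leey.
Qed.

End norms_and_integrals.

(** * Transfer of compactness from the radial profile to the kernel *)

Theorem corollary5p2 (R : realType) (d : nat) (d_ge1 : (1 <= d)%N)
    (p : R) (p_ge1 : 1 <= p)
    (Omega : set 'rV[R]_d)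
    (Omega_open : open Omega) (Omega_bounded : bounded_set Omega)
    (Omega_lipschitz : lipschitz_boundary Omega)
    (nrm : 'rV[R]_d -> R) (nrm_norm : is_norm nrm)
    (K : 'rV[R]_d -> \bar R) (K_kernel : kernel_on_Rd K)
    (K_not_L1 : ~ (\int[lebesgue_rV d]_z K z < +oo)%E)
    (K_almost_decreasing : exists c0 : R, [/\ 0 < c0, c0 <= 1 &
       forall x y, nrm x <= nrm y -> (c0%:E * K y <= K x)%E])
    (K_doubling : exists D C_D : R, [/\ 0 < D, 0 < C_D &
       forall x y, nrm y = 2 * nrm x -> nrm x <= D -> (K x <= C_D%:E * K y)%E])
    (K_levy : (\int[lebesgue_rV d]_z
                 (K z * (Num.min 1 (norm2 z `^ p))%:E) < +oo)%E) :
  forall u_ : nat -> 'rV[R]_d -> R,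
    (forall k, WKp_space K p Omega (u_ k)) ->
    (ereal_sup [set WKp_norm K p Omega (u_ k) | k in [set: nat]] < +oo)%E ->
  exists (phi : nat -> nat) (u : 'rV[R]_d -> R),
    [/\ {homo phi : m n / (m < n)%N},
        WKp_space K p Omega u &
        (fun j => Lp_norm p Omega (u_ (phi j) \- u)) @ \oo --> 0%E].
Proof.
move=> u_ uW supfin.
have p0 : 0 < p by exact: lt_le_trans p_ge1.
have mO : measurable Omega by exact: open_measurable_rV.
have [_ K0 _] := K_kernel.
have [c0 [c00 _ Kdec]] := K_almost_decreasing.
pose kap := radial_profile nrm K.
have kap0 r : (0 <= kap r)%E by exact: radial_profile_ge0.
have mkap : measurable_fun setT kap by exact: measurable_radial_profile.
have kapd r s : r <= s -> (kap s <= kap r)%E by exact: radial_profile_nonincreasing.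
have Kkap z : (K z <= kap (nrm z))%E by exact: radial_profile_ge.
have kapK z : (c0%:E * kap (nrm z) <= K z)%E by exact: radial_profile_le.
have mnrm : measurable_fun setT nrm.
  by apply: continuous_measurable_rV; exact: is_norm_continuous.
have mkn : measurable_fun setT (fun z => kap (nrm z)).
  exact: (measurableT_comp mkap mnrm).
have kap_notL1 : ~ (\int[lebesgue_rV d]_z kap (nrm z) < +oo)%E.
  move=> h; apply: K_not_L1; apply: le_lt_trans h.
  exact: ge0_le_integral_nomeas.
have kap_tail (r : R) : 0 < r ->
    (\int[lebesgue_rV d]_(z in [set z | (r <= nrm z)%R]) kap (nrm z) < +oo)%E.
  move=> r0; have [C C0 nrmC] := is_norm_equiv nrm_norm.
  (* Where [nrm z >= r], [norm2 z >= r / C], so [m0] bounds the minimum in [K_levy] from below and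
     [c0 * m0 * kap (nrm z)] is at most its integrand. *)
  pose m0 : R := Num.min 1 ((r / C) `^ p).
  have m00 : 0 < m0 by rewrite lt_min ltr01 powR_gt0// divr_gt0.
  have mE : measurable [set z | r <= nrm z].
    have := mnrm measurableT _ (measurable_itv `[r, +oo[).
    by rewrite setTI; congr (measurable _); apply/seteqP; split=> z /=;
      rewrite in_itv/= andbT.
  have cm0 : 0 < c0 * m0 by rewrite mulr_gt0.
  suff : ((c0 * m0)%:E *
      \int[lebesgue_rV d]_(z in [set z | (r <= nrm z)%R]) kap (nrm z) < +oo)%E.
    by rewrite -lte_pdivlMl// gt0_muley// lte_fin invr_gt0.
  rewrite -ge0_integralZl_EFin//; last 2 first.
  - exact: measurable_funTS.
  - exact: ltW.
  apply: le_lt_trans K_levy; rewrite [leLHS]integral_mkcond.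
  have min0 z : 0 <= Num.min 1 (norm2 z `^ p) :> R.
    by rewrite le_min ler01 powR_ge0.
  apply: ge0_le_integral_nomeas => z _.
    by apply: erestrict_ge0 => x _; rewrite mule_ge0// lee_fin ltW.
  rewrite /patch; case: ifPn => [|_]; last by rewrite mule_ge0// lee_fin.
  rewrite inE /= => rz; rewrite mulrC EFinM -muleA muleC lee_pmul//.
  - by rewrite mule_ge0// lee_fin ltW.
  - by rewrite lee_fin ltW.
  rewrite lee_fin /m0 le_min ge_min lexx /= ge_min; apply/orP; right.
  rewrite ge0_ler_powR ?nnegrE ?(ltW p0)// ?divr_ge0 ?(ltW r0) ?(ltW C0)//.
    exact: sqrtr_ge0.
  apply: le_trans (norm_le_norm2 z); rewrite ler_pdivrMr// mulrC.
  exact: le_trans rz (nrmC z).1.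
have [M M0 hM] : exists2 M : R, 0 <= M & forall k, (WKp_norm K p Omega (u_ k) <= M%:E)%E.
  pose s := ereal_sup [set WKp_norm K p Omega (u_ k) | k in [set: nat]].
  have hs k : (WKp_norm K p Omega (u_ k) <= s)%E.
    by apply: ereal_sup_ubound; exists k.
  have s0 : (0 <= s)%E.
    by apply: le_trans (hs 0%N); rewrite adde_ge0// ?Lnorm_ge0// poweR_ge0.
  exists (fine s); first exact: fine_ge0.
  by move=> k; rewrite fineK// ge0_fin_numE.
have dK0 (v : 'rV[R]_d -> R) : (0 <= \int[lebesgue_rV d]_(y in Omega) \int[lebesgue_rV d]_(x in Omega)
     ((`|v x - v y| `^ p)%:E * K (x - y)%R))%E.
  apply: integral_ge0 => y _; apply: integral_ge0 => x _.
  by rewrite mule_ge0// lee_fin powR_ge0.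
have uLp k : (\int[lebesgue_rV d]_(x in Omega) (`|u_ k x| `^ p)%:E <= (M `^ p)%:E)%E.
  apply: poweRV_le => //; first by apply: integral_ge0 => x _; rewrite lee_fin powR_ge0.
  rewrite -Lp_normE//; apply: le_trans (hM k).
  by rewrite leeDl// poweR_ge0.
have usemi k : (\int[lebesgue_rV d]_(y in Omega) \int[lebesgue_rV d]_(x in Omega)
     ((`|u_ k x - u_ k y| `^ p)%:E * K (x - y)%R) <= (M `^ p)%:E)%E.
  apply: poweRV_le => //; apply: le_trans (hM k).
  by rewrite leeDr// Lnorm_ge0.
have /choice[v_ hv] k := borel_modification mO (uW k).1.1.
have mv k : measurable_fun setT (v_ k) by have [] := hv k.
have uv k : {ae lebesgue_rV d, forall x, Omega x -> u_ k x = v_ k x}.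
  by have [] := hv k.
have vLp k : (\int[lebesgue_rV d]_(x in Omega) (`|v_ k x| `^ p)%:E <= (M `^ p)%:E)%E.
  apply: le_trans (uLp k); apply: ge0_ae_le_integral.
  - by move=> x _; rewrite lee_fin powR_ge0.
  - by move=> x _; rewrite lee_fin powR_ge0.
  - by apply: filterS (uv k) => x + Ox => ->.
(* The bound [c0 * kap <= K] turns the seminorm for [K] into one for [kap], at the price of the
   factor [c0^-1]. *)
have vsemi k : (\int[lebesgue_rV d]_(y in Omega) \int[lebesgue_rV d]_(x in Omega)
    radial_pdiff nrm p kap (v_ k) x y <= (c0^-1 * M `^ p)%:E)%E.
  rewrite EFinM lee_pdivlMl// -double_integral_scale//; last by rewrite lee_fin ltW.
  have cr0 x y : (0 <= radial_pdiff nrm p (fun r => c0%:E * kap r) (v_ k) x y)%E.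
    by apply: radial_pdiff_ge0 => r; rewrite mule_ge0// lee_fin ltW.
  apply: le_trans (usemi k); apply: ge0_ae_le_integral.
  - by move=> y _; apply: integral_ge0.
  - move=> y _; apply: integral_ge0 => x _.
    by rewrite mule_ge0// lee_fin powR_ge0.
  apply: filterS (uv k) => y + Oy => /(_ Oy) uy.
  apply: ge0_ae_le_integral => // [x _|]; first by rewrite mule_ge0// lee_fin powR_ge0.
  apply: filterS (uv k) => x + Ox => /(_ Ox) ux.
  by rewrite /radial_pdiff ux uy lee_wpmul2l// lee_fin powR_ge0.
have [phi [u [phi_incr mu_ uLpM usemiM uconv]]] :=
  radial_compactness d_ge1 nrm_norm Omega_open Omega_bounded Omega_lipschitz
    kap0 mkap kapd kap_tail kap_notL1 p0 (powR_ge0 _ _) mv vLp vsemi.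
exists phi, u; split=> //.
  split; [split|].
  - by apply: borel_lebesgue_measurable => //; exact: measurable_funTS.
  - by rewrite Lp_normE// poweR_lty// (le_lt_trans uLpM)// ltry.
  (* Here the opposite comparison [K <= kap] brings the limit back to the space of [K]. *)
  - rewrite poweR_lty//; apply: (le_lt_trans _ (ltry (c0^-1 * M `^ p))).
    apply: le_trans usemiM; apply: ge0_le_integral_nomeas => y _.
      apply: integral_ge0 => x _.
      by rewrite mule_ge0// lee_fin powR_ge0.
    apply: ge0_le_integral_nomeas => x _.
      by rewrite mule_ge0// lee_fin powR_ge0.
    by rewrite lee_wpmul2l// lee_fin powR_ge0.
have pow0 (t : R) : (0 <= (t `^ p)%:E)%E by rewrite lee_fin powR_ge0.
(* The [L^p] distance to [u] is at most [2^-j], since [u_ (phi j)] equals its Borel representative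
   almost everywhere on [Omega]. *)
apply: (@squeeze_cvge _ _ _ _ (cst 0%E) _ (fun j => (2^-1 ^+ j)%:E)).
- apply: nearW => j; rewrite /= Lnorm_ge0 /= Lp_normE//.
  have half0 : (0 <= 2^-1 ^+ j :> R) by rewrite exprn_ge0// invr_ge0.
  rewrite (_ : (2^-1 ^+ j)%:E = (((2^-1 ^+ j) `^ p)%:E `^ p^-1)%E); last first.
    by rewrite poweR_EFin -powRrM mulfV ?gt_eqF// powRr1.
  have le_j : (\int[lebesgue_rV d]_(x in Omega) (`|(u_ (phi j) \- u) x| `^ p)%:E <=
      ((2^-1 ^+ j) `^ p)%:E)%E.
    apply: le_trans (uconv j); apply: ge0_ae_le_integral => //.
    by apply: filterS (uv (phi j)) => x + Ox => /= ->.
  rewrite gt0_ler_poweR ?invr_ge0 ?(ltW p0)// in_itv/= leey andbT//.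
  exact: integral_ge0.
- exact: cvg_cst.
- apply/cvg_EFin; first exact: nearW.
  have := @cvg_geometric R 1 2^-1.
  rewrite ger0_norm ?invr_ge0// invf_lt1// ltr1n => /(_ isT).
  suff -> : geometric 1 2^-1 = (fun j => 2^-1 ^+ j : R) by [].
  by apply/funext => j /=; exact: mul1r.
Qed.
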